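(* Let $f$ be a polynomial of degree $d$ whose zero set $Z(f)$ satisfies $\emptyset\ne Z(f)\subset\mathbb T$, and let $\alpha\in\mathbb R$. (i) For $1<p<\infty$, $f$ is cyclic in $\ell^{p,\alpha}_A$ if and only if $\alpha\le p-1$. In $\ell^{1,\alpha}_A$, $f$ is cyclic if and only if $\alpha<0$. In $\ell^{\infty,\alpha}_A$, $f$ is cyclic if and only if $\alpha\le1$. (ii) Let $1\le p<\infty$ and let $\{p_n\}_{n\in\mathbb N}$ be a sequence of optimal polynomial approximants to $1/f$ in $\ell^{p,\alpha}_A$ of the corresponding orders. Then $$\|1-p_nf\|^p_{\ell^{p,\alpha}_A}\approx\begin{cases}(n+d+1)^{\alpha+1-p}&\text{if }\alpha<p-1,\\ \big(\log(n+d+2)\big)^{1-p}&\text{if }\alpha=p-1,\\ 1&\text{if }\alpha>p-1.\end{cases}$$ (iii) Let $\{p_n\}_{n\in\mathbb N}$ be a sequence of optimal polynomial approximants to $1/f$ in $\ell^{\infty,\alpha}_A$ of the corresponding orders. Then $$\|1-p_nf\|_{\ell^{\infty,\alpha}_A}\approx\begin{cases}(n+d+1)^{\alpha-1}&\text{if }\alpha<1,\\ \big(\log(n+d+2)\big)^{-1}&\text{if }\alpha=1,\\ 1&\text{if }\alpha>1.\end{cases}$$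
   Context: $\mathbb N$ denotes the non-negative integers, $\mathbb D$ the open unit disc of $\mathbb C$ and $\mathbb T$ the unit circle. For $\alpha\in\mathbb R$ and $1\le p<\infty$, $\ell^{p,\alpha}_A$ is the space of analytic functions $g(z)=\sum_{k\in\mathbb N}a_kz^k$ on $\mathbb D$ with finite norm $\|g\|_{\ell^{p,\alpha}_A}=\big(\sum_{k=0}^\infty|a_k|^p(k+1)^\alpha\big)^{1/p}$; and $\ell^{\infty,\alpha}_A$ is the space of such $g$ with finite norm $\|g\|_{\ell^{\infty,\alpha}_A}=\sup_{k\in\mathbb N}|a_k|(k+1)^\alpha$. The shift is $(Sg)(z)=zg(z)$, and $[f]$ denotes the smallest closed subspace of the given space that contains $f$ and is invariant under $S$. The function $f$ is called cyclic in the given space ($\ell^{p,\alpha}_A$, $1\le p\le\infty$) if $[f]$ is the whole space. $\mathcal P_n$ is the space of polynomials of degree at most $n$. A polynomial $p_n\in\mathcal P_n$ is an optimal polynomial approximant of order $n$ to $1/f$ in a given space if $\|1-p_nf\|=\inf_{P\in\mathcal P_n}\|1-Pf\|$ in the norm of that space. (For $p=1$ and $p=\infty$ it need not be unique; any choice is allowed.) $A(n)\approx B(n)$ means that there is a constant $C>0$ independent of $n\in\mathbb N$ such that $C^{-1}B(n)\le A(n)\le CB(n)$ for all $n\in\mathbb N$.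
   Formalization: For p=∞ the polynomials are not norm dense, so no polynomial f is cyclic in the norm sense; ''cyclic iff α≤1'' is instead proved with [f] weak-* closed and equal to the whole space, and also with norm-closed [f] equal to the norm closure of the polynomials. *)

(* Defs.v *)
From mathcomp Require Export all_boot all_order all_algebra.
From mathcomp Require Export all_classical all_reals all_analysis.
From mathcomp Require Export complex.
Export Order.TTheory GRing.Theory Num.Theory numFieldNormedType.Exports.

Set Implicit Arguments.
Unset Strict Implicit.
Unset Printing Implicit Defensive.

Local Open Scope classical_set_scope.
Local Open Scope ring_scope.

(* Functions on the open unit disc are functions on the subtype [disc R], so that
   equality of functions is equality on the disc. *)
Definition disc (R : realType) := {z : R[i] | `|z| < 1}.

Definition disc_fun (R : realType) := disc R -> R[i].

(* The modulus as an element of R; `|z| lives in R[i]. *)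
Notation modulus := ComplexField.Normc.normc.

Definition is_taylor (R : realType) (g : disc_fun R) (a : nat -> R[i]) : Prop :=
  forall z : disc R, series (fun k => a k * \val z ^+ k) @ \oo --> (g z : R[i]^o).

Definition analytic (R : realType) (g : disc_fun R) : Prop :=
  exists a, is_taylor g a.

(* Power series expansions on the disc are unique, so this is the sequence of
   Taylor coefficients of g when g is analytic (and 0 otherwise). *)
Definition taylor (R : realType) (g : disc_fun R) : nat -> R[i] :=
  xget (fun=> 0) [set a | is_taylor g a].

Definition poly_fun (R : realType) (P : {poly R[i]}) : disc_fun R :=
  fun z => P.[\val z].

Definition shift (R : realType) (g : disc_fun R) : disc_fun R :=
  fun z => \val z * g z.

Definition lnorm (R : realType) (p : \bar R) (alpha : R) (g : disc_fun R) : \bar R :=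
  match p with
  | r%:E => poweR (\sum_(0 <= k <oo)
                     (modulus (taylor g k) `^ r * k.+1%:R `^ alpha)%:E)%E r^-1
  | +oo%E => ereal_sup [set (modulus (taylor g k) * k.+1%:R `^ alpha)%:E
                       | k in [set: nat]]
  | -oo%E => 0%E
  end.

Definition lspace (R : realType) (p : \bar R) (alpha : R) : set (disc_fun R) :=
  [set g | analytic g /\ (lnorm p alpha g < +oo)%E].

Definition norm_closure (R : realType) (p : \bar R) (alpha : R)
    (M : set (disc_fun R)) : set (disc_fun R) :=
  [set g | lspace p alpha g /\
     forall e : R, 0 < e -> exists2 h, M h & (lnorm p alpha (g \- h)%R < e%:E)%E].

(* l^{oo,alpha}_A is the dual of the space of sequences b with
   \sum |b_k| (k+1)^{-alpha} < oo, for the pairing \sum a_k b_k. *)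
Definition predual (R : realType) (alpha : R) (b : nat -> R[i]) : Prop :=
  (\sum_(0 <= k <oo) (modulus (b k) * k.+1%:R `^ (- alpha))%:E < +oo)%E.

Definition is_pairing (R : realType) (g : disc_fun R) (b : nat -> R[i])
    (l : R[i]) : Prop :=
  series (fun k => taylor g k * b k) @ \oo --> (l : R[i]^o).

Definition weak_star_closure (R : realType) (alpha : R)
    (M : set (disc_fun R)) : set (disc_fun R) :=
  [set g | lspace +oo%E alpha g /\
     forall (m : nat) (b : 'I_m -> nat -> R[i]) (e : R),
       0 < e -> (forall j, predual alpha (b j)) ->
       exists2 h, M h & forall j, exists2 l,
         is_pairing (g \- h)%R (b j) l & modulus l < e].

Definition invariant_subspace (R : realType) (p : \bar R) (alpha : R)
    (M : set (disc_fun R)) : Prop :=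
  [/\ M `<=` lspace p alpha,
      M (fun=> 0),
      forall (c : R[i]) g h, M g -> M h -> M (fun z => c * g z + h z)
    & forall g, M g -> M (shift g)].

(* [f]: the smallest cl-closed invariant subspace that contains f. *)
Definition generated (R : realType) (p : \bar R) (alpha : R)
    (cl : set (disc_fun R) -> set (disc_fun R)) (f : disc_fun R) :
    set (disc_fun R) :=
  smallest (fun M => invariant_subspace p alpha M /\ cl M `<=` M) [set f].

Definition cyclic (R : realType) (p : \bar R) (alpha : R) (f : disc_fun R) : Prop :=
  generated p alpha (norm_closure p alpha) f = lspace p alpha.

(* In the norm topology of l^{oo,alpha}_A the multiples of a polynomial f by
   polynomials stay in the norm closure of the polynomials, a proper subspace, so
   no polynomial satisfies [cyclic +oo alpha]. Cyclicity in l^{oo,alpha}_A is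
   therefore taken in either of two senses: in the weak-star topology, or in the
   norm topology with the closure of the polynomials as the whole space. *)
Definition weak_star_cyclic (R : realType) (alpha : R) (f : disc_fun R) : Prop :=
  generated +oo%E alpha (weak_star_closure alpha) f = lspace +oo%E alpha.

Definition norm_cyclic_infty (R : realType) (alpha : R) (f : disc_fun R) : Prop :=
  generated +oo%E alpha (norm_closure +oo%E alpha) f =
  norm_closure +oo%E alpha (range (@poly_fun R)).

Definition residual_norm (R : realType) (p : \bar R) (alpha : R)
    (f P : {poly R[i]}) : \bar R :=
  lnorm p alpha (poly_fun (1 - P * f)).

(* P is a polynomial of degree at most n when size P <= n.+1. *)
Definition optimal_approximant (R : realType) (p : \bar R) (alpha : R)
    (f : {poly R[i]}) (n : nat) (P : {poly R[i]}) : Prop :=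
  (size P <= n.+1)%N /\
  residual_norm p alpha f P =
    ereal_inf [set residual_norm p alpha f Q |
                 Q in [set Q : {poly R[i]} | (size Q <= n.+1)%N]].

Definition comparable (R : realType) (A : nat -> \bar R) (B : nat -> R) : Prop :=
  exists2 C : R, 0 < C &
    forall n, ((C^-1 * B n)%:E <= A n /\ A n <= (C * B n)%:E)%E.

(* Main.v *)
(** A residual r = 1 - Q f with deg Q <= n is a polynomial of degree at most n + d
    with r(z0) = 1 at any zero z0 of f, so that sum_{k <= n+d} |r_k| >= 1, and a
    weighted Hoelder estimate bounds its norm from below.

    Conversely let rho = sum_k c_k X^k have nonnegative coefficients, rho(1) = 1 and
    rho(0) = 0.  If z_1, ..., z_d are the zeros of f, then
    r = 1 - prod_j (1 - rho(X / z_j)) is of the form 1 - Q f, and its coefficients are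
    dominated by those of (1 + rho)^d - 1; differentiating the latter,
    k |r_k| <= d 2^(d-1) max_j j c_j.  Uniform coefficients c_k on [M, 2M) attain the
    power rates and c_k proportional to 1/k the logarithmic ones; Q = 0 does when
    alpha is larger.

    When residuals tend to 0, the constant 1, hence every polynomial, lies in every
    closed invariant subspace that contains f.  Otherwise evaluation at z0 is a bounded
    functional, whose kernel is a proper closed invariant subspace. *)
Require Import Defs.
From mathcomp Require Import ring lra zify.

Set Implicit Arguments.
Unset Strict Implicit.
Unset Printing Implicit Defensive.

Local Open Scope classical_set_scope.
Local Open Scope ring_scope.

(** * Sums of powers *)

Section RealSums.
Variable R : realType.
Implicit Types (x y s t a b p alpha : R) (k n N : nat).

(** Since [rho(1) = 1], the factor [1 - rho(X / z_j)] vanishes at [z_j]; one factor per root,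
    counted with multiplicity, makes [f] divide the product, and [|z_j| = 1] preserves the moduli of
    coefficients, so one nonnegative majorant serves all positions of the zeros. The bound on
    [k |r_k|] alone does not give the power rates: for [alpha < p - 1] the series of [k^(alpha - p)]
    converges, so [|r_k| <= C / k] yields a bound without decay. The low coefficients have to
    vanish, which is why the uniform block starts at [M]: what survives has [k] comparable to [n],
    where all weights are comparable whatever the sign of [alpha]. At [alpha = p - 1] every dyadic
    block costs the same, so a single block gains nothing and the mass is spread over all scales, as
    [1/k] does. The lower bounds hold for every [Q] of admissible degree, so optimal approximants
    enter only through the value of the infimum. *)

Lemma powR_succD k a b : (k.+1%:R : R) `^ (a + b) = k.+1%:R `^ a * k.+1%:R `^ b.
Proof. by rewrite powRD // pnatr_eq0 implybT. Qed.

Lemma powR_succ_gt0 k a : 0 < (k.+1%:R : R) `^ a.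
Proof. by rewrite powR_gt0 // ltr0n. Qed.

Lemma ln_le_subr1 y : 0 < y -> ln y <= y - 1.
Proof.
move=> y0; have -> : ln y = ln (1 + (y - 1)) by congr ln; ring.
by apply: le_ln1Dx; lra.
Qed.

(** With [u = s * (1 - y)], [ln y <= y - 1] gives [y^s <= 1 / (1 + u)], and this is at most
    [1 - u / 2] because [u <= 1]. Taken at [y = N / (N + 1)] it bounds the increments of [N^s] from
    below. *)
Lemma powR_le_linear s y : 0 < s <= 1 -> 0 <= y <= 1 -> y `^ s <= 1 - s * (1 - y) / 2.
Proof.
move=> /andP[s0 s1] /andP[]; rewrite le_eqVlt => /predU1P[<- _|y0 y1].
  by rewrite powR0 ?gt_eqF //; lra.
have ly := ln_le_subr1 y0.
set u := s * (1 - y); have u0 : 0 <= u by rewrite mulr_ge0 //; lra.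
have u1 : u <= 1 by rewrite /u; nra.
have -> : y `^ s = (expR (- (s * ln y)))^-1.
  by rewrite expRN invrK /powR gt_eqF.
have h : 1 + u <= expR (- (s * ln y)).
  apply: le_trans (expR_ge1Dx _); rewrite lerD2l /u -mulrN ler_pM2l //; lra.
apply: (@le_trans _ _ (1 + u)^-1).
  by rewrite lef_pV2 // posrE ?expR_gt0 //; lra.
rewrite -[X in X <= _]mul1r ler_pdivrMr; last lra.
nra.
Qed.

Lemma powRN_ge_linear s y : 0 < s -> 0 < y <= 1 -> 1 + s * (1 - y) <= y `^ (- s).
Proof.
move=> s0 /andP[y0 y1].
have ly := ln_le_subr1 y0.
rewrite /powR gt_eqF //; apply: le_trans (expR_ge1Dx _); rewrite lerD2l mulNr -mulrN ler_pM2l //; lra.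
Qed.

(** For [b <= 0] the last term is the largest. For [0 < b < 1] the sum telescopes against [N^s] with
    [s = 1 - b], whose increment is at least [(s / 2) * (N + 1)^(- b)]; hence the constant
    [2 / s]. *)
Lemma sum_powRN_le b : b < 1 ->
  exists2 C : R, 0 < C & forall N, \sum_(0 <= k < N) k.+1%:R `^ (- b) <= C * N%:R `^ (1 - b).
Proof.
move=> b1; have [b0|b0] := lerP b 0.
  exists 1 => // N; rewrite mul1r.
  case: N => [|N]; first by rewrite big_geq // powR_ge0.
  rewrite addrC powR_succD powRr1 ?ler0n //.
  have -> : (N.+1%:R : R) `^ (- b) * N.+1%:R = \sum_(0 <= k < N.+1) (N.+1%:R : R) `^ (- b).
    by rewrite sumr_const_nat subn0 mulr_natr.
  apply: ler_sum_nat => k /andP[_ kN].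
  by apply: ge0_ler_powR; rewrite ?nnegrE ?ler0n ?ler_nat //; lra.
set s := 1 - b; have s0 : 0 < s by rewrite /s; lra.
exists (2 / s); first by rewrite divr_gt0.
elim=> [|N IH]; first by rewrite big_geq // mulr_ge0 ?powR_ge0 // divr_ge0 // ltW.
rewrite big_nat_recr //=; apply: (le_trans (lerD IH (lexx _))).
have N0 : 0 < (N.+1%:R : R) by rewrite ltr0n.
have -> : (N%:R : R) `^ s = N.+1%:R `^ s * (N%:R / N.+1%:R) `^ s.
  by rewrite -powRM ?divr_ge0 ?ler0n // mulrC divfK // gt_eqF.
have -> : (N.+1%:R : R) `^ (- b) = N.+1%:R `^ s / N.+1%:R.
  have -> : - b = s + (-1) by rewrite /s; ring.
  by rewrite powR_succD powR_inv1 ?ler0n.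
have h : ((N%:R : R) / N.+1%:R) `^ s <= 1 - s * (1 - N%:R / N.+1%:R) / 2.
  apply: powR_le_linear; first by rewrite s0 /=; rewrite /s; lra.
  by rewrite divr_ge0 ?ler0n //= ler_pdivrMr // mul1r ler_nat.
have e : 1 - (N%:R : R) / N.+1%:R = N.+1%:R^-1.
  apply: (mulIf (lt0r_neq0 N0)); rewrite mulrBl divfK ?mulVf ?gt_eqF // mul1r.
  by rewrite -natrB // subSnn.
rewrite e in h.
have P := powR_succ_gt0 N s.
have := ler_wpM2l (ltW (mulr_gt0 (divr_gt0 (ltr0Sn _ 1) s0) P)) h.
set A := N.+1%:R `^ s; set B := (N%:R / N.+1%:R) `^ s; set D := N.+1%:R^-1.
have -> : 2 / s * A * (1 - s * D / 2) = 2 / s * A - A * D.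
  by field; rewrite gt_eqF.
rewrite -/A; lra.
Qed.

Lemma sum_powRN_bounded b : 1 < b ->
  exists2 C : R, 0 < C & forall N, \sum_(0 <= k < N) k.+1%:R `^ (- b) <= C.
Proof.
move=> b1; set s := b - 1; have s0 : 0 < s by rewrite /s; lra.
exists (1 + s^-1); first by rewrite addr_gt0 ?invr_gt0.
(* The induction closes only with the tail subtracted: [N.+1^(- s) / s] is the integral of [x^(- b)]
   over [x >= N.+1]. *)
suff H : forall N, \sum_(0 <= k < N.+1) k.+1%:R `^ (- b) <= 1 + s^-1 * (1 - N.+1%:R `^ (- s)).
  case=> [|N]; first by rewrite big_geq // addr_ge0 // invr_ge0 ltW.
  by apply: (le_trans (H N)); rewrite lerD2l -[leRHS]mulr1 ler_pM2l ?invr_gt0 // gerBl powR_ge0.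
elim=> [|N IH]; first by rewrite big_nat1 !powR1 subrr mulr0 addr0.
rewrite big_nat_recr //=; apply: (le_trans (lerD IH (lexx _))).
have N0 : 0 < (N.+1%:R : R) by rewrite ltr0n.
have N1 : 0 < (N.+2%:R : R) by rewrite ltr0n.
have -> : (N.+1%:R : R) `^ (- s) = N.+2%:R `^ (- s) * (N.+1%:R / N.+2%:R) `^ (- s).
  by rewrite -powRM ?divr_ge0 ?ler0n // mulrC divfK // gt_eqF.
have -> : (N.+2%:R : R) `^ (- b) = N.+2%:R `^ (- s) / N.+2%:R.
  have -> : - b = - s + (-1) by rewrite /s; ring.
  by rewrite powR_succD powR_inv1 ?ler0n.
have h : 1 + s * (1 - (N.+1%:R : R) / N.+2%:R) <= (N.+1%:R / N.+2%:R) `^ (- s).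
  apply: powRN_ge_linear => //.
  by rewrite divr_gt0 ?ltr0n //= ler_pdivrMr // mul1r ler_nat.
have e : 1 - (N.+1%:R : R) / N.+2%:R = N.+2%:R^-1.
  apply: (mulIf (lt0r_neq0 N1)); rewrite mulrBl divfK ?mulVf ?gt_eqF // mul1r.
  by rewrite -natrB // subSnn.
rewrite e in h.
have P := powR_succ_gt0 N.+1 (- s).
have := ler_wpM2l (ltW (divr_gt0 P s0)) h.
set A := N.+2%:R `^ (- s); set B := (_ / _) `^ (- s); set D := N.+2%:R^-1.
have -> : A / s * (1 + s * D) = A / s + A * D by field; rewrite gt_eqF.
by rewrite !mulrBr !mulr1 -/A mulrA [s^-1 * A]mulrC; lra.
Qed.

Lemma ln_le_harmonic N : ln (N.+1%:R : R) <= \sum_(0 <= k < N) k.+1%:R^-1.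
Proof.
elim: N => [|N IH]; first by rewrite big_geq // ln1.
rewrite big_nat_recr //=.
have N0 : 0 < (N.+1%:R : R) by rewrite ltr0n.
have -> : (N.+2%:R : R) = N.+1%:R * (1 + N.+1%:R^-1).
  by rewrite mulrDr mulr1 mulfV ?gt_eqF // [LHS]mulrS addrC.
rewrite lnM ?posrE ?addr_gt0 ?invr_gt0 //; apply: lerD => //.
by apply: le_ln1Dx; apply: lt_trans (_ : 0 < _); rewrite ?invr_gt0 //; lra.
Qed.

(** The factor 2 absorbs the shift of index: [1 / (N + 1) <= 2 / (N + 2) <= 2 * ln ((N + 2) / (N +
    1))]. *)
Lemma harmonic_le_ln N : \sum_(0 <= k < N) k.+1%:R^-1 <= 2 * ln (N.+1%:R : R).
Proof.
elim: N => [|N IH]; first by rewrite big_geq // ln1 mulr0.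
rewrite big_nat_recr //=; apply: (le_trans (lerD IH (lexx _))).
have N0 : 0 < (N.+1%:R : R) by rewrite ltr0n.
have N1 : 0 < (N.+2%:R : R) by rewrite ltr0n.
have h : ln (N.+1%:R / N.+2%:R : R) <= - N.+2%:R^-1.
  have -> : (N.+1%:R / N.+2%:R : R) = 1 + - N.+2%:R^-1.
    apply: (mulIf (lt0r_neq0 N1)); rewrite divfK ?gt_eqF // mulrDl mulNr mulVf ?gt_eqF //.
    by rewrite mul1r [N.+2%:R]mulrSr addrK.
  apply: le_ln1Dx; rewrite ltrN2 invf_lt1 //; rewrite (ltr_nat R 1); lia.
rewrite ln_div ?posrE // in h.
have h2 : (N.+1%:R : R)^-1 <= 2 * N.+2%:R^-1.
  rewrite -[leLHS]mul1r ler_pdivrMr // mulrAC ler_pdivlMr // mul1r -natrM ler_nat; lia.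
move: h h2; move: (ln _) (ln _) (_^-1) (_^-1) => x y z t; lra.
Qed.

End RealSums.

(** * Lower bounds for weighted sums *)

Section Evaluation.
Variable R : realType.
Implicit Types (x v w : nat -> R) (s t a b p alpha : R) (k n N : nat).

(* Splits according to [a <= t * b]; it replaces Hoelder's inequality up to a
   constant, and unlike it covers [p = 1]. *)
Lemma le_threshold p a b t : 1 <= p -> 0 <= a -> 0 < b -> 0 < t ->
  a <= t * b + t `^ (1 - p) * (b `^ (1 - p) * a `^ p).
Proof.
move=> p1 a0 b0 t0; rewrite mulrA -powRM ?(ltW b0) ?(ltW t0) //.
have tb0 : 0 < t * b by rewrite mulr_gt0.
have [le_a|lt_a] := lerP a (t * b).
  by apply: (le_trans le_a); rewrite lerDl mulr_ge0 ?powR_ge0.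
have a1 : 0 < a by apply: lt_trans lt_a.
apply: (@le_trans _ _ ((t * b) `^ (1 - p) * a `^ p)); last by rewrite lerDr (ltW tb0).
have {1}-> : a = a `^ (1 - p) * a `^ p.
  by rewrite -powRD ?(gt_eqF a1) ?implybT // subrK powRr1 ?(ltW a1).
rewrite ler_pM2r ?powR_gt0 //.
rewrite -[1 - p]opprB !powRN lef_pV2 ?posrE ?powR_gt0 //.
by apply: ge0_ler_powR; rewrite ?nnegrE ?subr_ge0 ?(ltW tb0) ?(ltW a1) ?(ltW lt_a).
Qed.

(** [v] stands for the conjugate weight [w^(- 1 / (p - 1))] of Hoelder's inequality. Asking only for
    an inequality between [v^(1 - p)] and [w] keeps [p = 1] meaningful: there it reads
    [1 <= K * w k]. *)
Lemma sum_le_threshold p x v w (V K t : R) N : 1 <= p -> 0 < t ->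
  (forall k, 0 <= x k) -> (forall k, 0 < v k) ->
  (forall k, (k < N)%N -> v k `^ (1 - p) <= K * w k) ->
  \sum_(0 <= k < N) v k <= V ->
  \sum_(0 <= k < N) x k <=
    t * V + t `^ (1 - p) * K * \sum_(0 <= k < N) x k `^ p * w k.
Proof.
move=> p1 t0 x0 v0 vw vV.
apply: (@le_trans _ _ (\sum_(0 <= k < N) (t * v k + t `^ (1 - p) * K * (x k `^ p * w k)))).
  apply: ler_sum_nat => k /andP[_ kN].
  apply: (le_trans (le_threshold p1 (x0 k) (v0 k) t0)); rewrite lerD2l -!mulrA.
  rewrite ler_wpM2l ?powR_ge0 //.
  by rewrite [x k `^ p * _]mulrC mulrA ler_wpM2r ?powR_ge0 ?vw.
by rewrite big_split /= -!mulr_sumr lerD2r ler_pM2l.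
Qed.

Lemma weighted_sum_ge p x v w (V K : R) N : 1 <= p -> 0 < V -> 0 < K ->
  (forall k, 0 <= x k) -> (forall k, 0 < v k) ->
  (forall k, (k < N)%N -> v k `^ (1 - p) <= K * w k) ->
  \sum_(0 <= k < N) v k <= V -> 1 <= \sum_(0 <= k < N) x k ->
  (2 * V) `^ (1 - p) / (2 * K) <= \sum_(0 <= k < N) x k `^ p * w k.
Proof.
move=> p1 V0 K0 x0 v0 vw vV x1.
(* This threshold makes [t * V] equal to one half, so the weighted sum has to account for the other
   half. *)
have t0 : 0 < (2 * V)^-1 by rewrite invr_gt0 mulr_gt0.
have := le_trans x1 (sum_le_threshold p1 t0 x0 v0 vw vV).
have -> : (2 * V)^-1 * V = 2^-1 by field; rewrite gt_eqF.
have -> : (2 * V)^-1 `^ (1 - p) = ((2 * V) `^ (1 - p))^-1.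
  by rewrite -powR_inv1 ?mulr_ge0 ?ltW // -powRrM mulN1r powRN.
have : 0 < (2 * V) `^ (1 - p) by rewrite powR_gt0 ?mulr_gt0.
move: (_ `^ _) (\sum_(_ <= _ < _) _) => T S T0 h.
rewrite ler_pdivrMr ?mulr_gt0 //.
have h1 : 1 <= 2 * (T^-1 * K * S) by lra.
have := ler_wpM2l (ltW T0) h1; rewrite mulr1.
by have -> : T * (2 * (T^-1 * K * S)) = S * (2 * K) by field; rewrite gt_eqF.
Qed.

(** For [alpha <= 0] the constant [v = 1] suffices, with [K = N^(- alpha)] from the smallest weight;
    this includes [p = 1]. For [alpha > 0] one has [p > 1], and the conjugate weight has exponent
    [alpha / (p - 1) < 1], so its sum grows like a power of [N]. *)
Lemma weighted_sum_ge_lt p alpha : 1 <= p -> alpha < p - 1 ->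
  exists2 c : R, 0 < c & forall N x, (forall k, 0 <= x k) -> (0 < N)%N ->
    1 <= \sum_(0 <= k < N) x k ->
    c * N%:R `^ (alpha + 1 - p) <= \sum_(0 <= k < N) x k `^ p * k.+1%:R `^ alpha.
Proof.
move=> p1 ap; have [a0|a0] := lerP alpha 0.
  exists (2 `^ (1 - p) / 2); first by rewrite divr_gt0 ?powR_gt0.
  move=> [//|N] x x0 _ x1.
  have P := @powR_succ_gt0 R N.
  have := @weighted_sum_ge p x (fun=> 1) (fun k => k.+1%:R `^ alpha)
    N.+1%:R (N.+1%:R `^ (- alpha)) N.+1 p1 _ (P _) x0 _ _ _ x1.
  have -> : (2 * N.+1%:R) `^ (1 - p) / (2 * N.+1%:R `^ (- alpha)) =
     2 `^ (1 - p) / 2 * N.+1%:R `^ (alpha + 1 - p) :> R.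
    rewrite powRM ?ler0n // -addrA (powR_succD N alpha) (powRN _ alpha).
    by field; rewrite gt_eqF.
  apply => //.
  - by move=> k kN; rewrite powR1 powRN mulrC ler_pdivlMr // mul1r -[alpha]opprK
      [leLHS]powRN [leRHS]powRN lef_pV2 ?posrE ?powR_succ_gt0 // ge0_ler_powR ?nnegrE
      ?ler0n ?oppr_ge0 // ler_nat.
  - by rewrite sumr_const_nat subn0.
have p1' : 1 < p by lra.
have [|C C0 HC] := @sum_powRN_le R (alpha / (p - 1)).
  by rewrite ltr_pdivrMr ?mul1r ?subr_gt0.
exists ((2 * C) `^ (1 - p) / 2); first by rewrite divr_gt0 ?powR_gt0 ?mulr_gt0.
move=> [//|N] x x0 _ x1.
have P := @powR_succ_gt0 R N.
have := @weighted_sum_ge p x (fun k => k.+1%:R `^ (- (alpha / (p - 1))))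
  (fun k => k.+1%:R `^ alpha) _ 1 N.+1 p1 (mulr_gt0 C0 (P _)) ltr01 x0 _ _ (HC N.+1) x1.
rewrite mulr1 mulrA powRM ?mulr_ge0 ?powR_ge0 ?(ltW C0) // -powRrM.
have -> : (1 - alpha / (p - 1)) * (1 - p) = alpha + 1 - p by field; lra.
rewrite mulrAC; apply=> k; first exact: powR_succ_gt0.
move=> _; rewrite mul1r -powRrM.
by have -> : - (alpha / (p - 1)) * (1 - p) = alpha by field; lra.
Qed.

(** For [p > 1] the conjugate weight is exactly [1 / (k + 1)], whose sum is logarithmic. For [p = 1]
    the weight and the rate are both constant. *)
Lemma weighted_sum_ge_eq p : 1 <= p ->
  exists2 c : R, 0 < c & forall N x, (forall k, 0 <= x k) -> (0 < N)%N ->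
    1 <= \sum_(0 <= k < N) x k ->
    c * ln N.+1%:R `^ (1 - p) <= \sum_(0 <= k < N) x k `^ p * k.+1%:R `^ (p - 1).
Proof.
rewrite le_eqVlt => /predU1P[<-|p1].
  exists 1 => // N x x0 _ x1; rewrite subrr powRr0 mulr1.
  apply: (le_trans x1); apply: ler_sum_nat => k _.
  by rewrite powRr0 powRr1 // mulr1.
exists (4 `^ (1 - p) / 2); first by rewrite divr_gt0 ?powR_gt0.
move=> [//|N] x x0 _ x1.
have L0 : 0 < ln N.+2%:R :> R by rewrite ln_gt0 // (ltr_nat R 1).
have := @weighted_sum_ge p x (fun k => k.+1%:R^-1)
  (fun k => k.+1%:R `^ (p - 1)) _ 1 N.+1 (ltW p1) (mulr_gt0 (ltr0Sn _ 1) L0)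
  ltr01 x0 _ _ (@harmonic_le_ln R N.+1) x1.
rewrite mulr1 mulrA -natrM powRM ?(ltW L0) // mulrAC; apply=> k; first by rewrite invr_gt0.
by move=> _; rewrite mul1r -powR_inv1 // -powRrM mulN1r opprB.
Qed.

(** Here the conjugate weight is summable; for [p = 1] any summable positive sequence will do, since
    the weights are at least 1. The threshold [t = e] makes both terms of the estimate linear in
    [e], whence [C = V + 1]. The result bounds evaluation at every point of the unit circle. *)
Lemma evaluation_bounded p alpha : 1 <= p -> p - 1 < alpha \/ p = 1 /\ 0 <= alpha ->
  exists2 C : R, 0 < C & forall e N x, (forall k, 0 <= x k) -> 0 < e ->
    \sum_(0 <= k < N) x k `^ p * k.+1%:R `^ alpha <= e `^ p ->
    \sum_(0 <= k < N) x k <= C * e.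
Proof.
move=> p1 H.
have [v v0 [V V0 [vV vw]]] : exists2 v : nat -> R, forall k, 0 < v k &
    exists2 V : R, 0 < V & (forall N, \sum_(0 <= k < N) v k <= V) /\
     (forall k, v k `^ (1 - p) <= 1 * k.+1%:R `^ alpha).
  case: (eqVneq p 1) H => [-> H|p1' H].
    exists (fun k => k.+1%:R `^ (- 2)); first by move=> k; exact: powR_succ_gt0.
    have [V V0 HV] := @sum_powRN_bounded R 2 (ltac:(lra)).
    exists V => //; split=> // k; rewrite subrr powRr0 mul1r.
    rewrite -[leLHS](powRr0 k.+1%:R); apply: ler_powR; last by case: H => [|[]]; lra.
    by rewrite (ler_nat R 1).
  have {}p1' : 1 < p by rewrite lt_neqAle eq_sym p1'.
  have {}H : p - 1 < alpha by case: H => // -[]; lra.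
  exists (fun k => k.+1%:R `^ (- (alpha / (p - 1)))).
    by move=> k; exact: powR_succ_gt0.
  have [|V V0 HV] := @sum_powRN_bounded R (alpha / (p - 1)).
    by rewrite ltr_pdivlMr ?mul1r ?subr_gt0.
  exists V => //; split=> // k; rewrite mul1r -powRrM.
  by have -> : - (alpha / (p - 1)) * (1 - p) = alpha by field; lra.
exists (V + 1); first by lra.
move=> e N x x0 e0 h.
have := sum_le_threshold p1 e0 x0 v0 (fun k _ => vw k) (vV N).
move=> /le_trans; apply; rewrite mulr1 mulrDl mul1r [e * V]mulrC lerD2l.
apply: (le_trans (ler_wpM2l (powR_ge0 _ _) h)).
rewrite -powRD; last by rewrite (gt_eqF e0) implybT.
by rewrite subrK powRr1 ?(ltW e0).
Qed.

Lemma sum_le_sup alpha x (E : R) N : 0 <= E ->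
  (forall k, (k < N)%N -> x k * k.+1%:R `^ alpha <= E) ->
  \sum_(0 <= k < N) x k <= E * \sum_(0 <= k < N) k.+1%:R `^ (- alpha).
Proof.
move=> E0 h; rewrite mulr_sumr; apply: ler_sum_nat => k /andP[_ kN].
by rewrite powRN ler_pdivlMr ?powR_succ_gt0 ?h.
Qed.

End Evaluation.

(** * Polynomial majorants *)

Section Modulus.
Variable R : realType.
Implicit Types (x y z : R[i]).

Lemma normE z : `|z| = (modulus z)%:C%C. Proof. by []. Qed.

Lemma modulusE z : modulus z = complex.Re `|z|. Proof. by []. Qed.

Lemma modulus_ge0 z : 0 <= modulus z.
Proof. by case: z => a b; exact: sqrtr_ge0. Qed.

Lemma modulus0 : modulus (0 : R[i]) = 0.
Proof. exact: ComplexField.Normc.normc0. Qed.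

Lemma modulus1 : modulus (1 : R[i]) = 1.
Proof. exact: ComplexField.Normc.normc1. Qed.

Lemma modulusM x y : modulus (x * y) = modulus x * modulus y.
Proof. exact: ComplexField.Normc.normcM. Qed.

Lemma modulusV x : modulus x^-1 = (modulus x)^-1.
Proof. exact: ComplexField.Normc.normcV. Qed.

Lemma modulusN x : modulus (- x) = modulus x.
Proof. by rewrite !modulusE normrN. Qed.

Lemma modulusD x y : modulus (x + y) <= modulus x + modulus y.
Proof. exact: le_normcD. Qed.

Lemma modulusB x y : modulus (x - y) <= modulus x + modulus y.
Proof. by rewrite -(modulusN y) modulusD. Qed.

Lemma modulusX x n : modulus (x ^+ n) = modulus x ^+ n.
Proof.
by elim: n => [|n IH]; rewrite ?expr0 ?modulus1 // !exprS modulusM IH.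
Qed.

Lemma modulus_real (r : R) : 0 <= r -> modulus (r%:C%C) = r.
Proof. by move=> r0; rewrite /= expr0n /= addr0 sqrtr_sqr ger0_norm. Qed.

Lemma modulus_eq0 x : (modulus x == 0) = (x == 0).
Proof.
apply/eqP/eqP => [|->]; [exact: ComplexField.Normc.eq0_normc | exact: modulus0].
Qed.

Lemma modulus_sum I (s : seq I) (P : pred I) (F : I -> R[i]) :
  modulus (\sum_(i <- s | P i) F i) <= \sum_(i <- s | P i) modulus (F i).
Proof.
elim/big_rec2 : _ => [|i y x _ h]; first by rewrite modulus0.
by apply: (le_trans (modulusD _ _)); rewrite lerD2l.
Qed.

End Modulus.

(** * Residuals dominated coefficientwise by powers of [1 + rho] *)

Section Majorant.
Variable R : realType.
Implicit Types (rho : {poly R}) (P Q : {poly R[i]}) (b : R).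

(** The polynomial [rho(X / z)]. *)
Definition rotated rho (z : R[i]) : {poly R[i]} :=
  \poly_(k < size rho) ((rho`_k)%:C%C * z ^- k).

Lemma modulus_rotated rho z k : (forall k, 0 <= rho`_k) -> modulus z = 1 ->
  modulus (rotated rho z)`_k = rho`_k.
Proof.
move=> rho0 z1; rewrite coef_poly; case: ltnP => [_|le].
  by rewrite modulusM modulus_real // modulusV modulusX z1 expr1n invr1 mulr1.
by rewrite modulus0 nth_default.
Qed.

Lemma rotated_root rho z : rho.[1] = 1 -> modulus z = 1 -> (rotated rho z).[z] = 1.
Proof.
move=> rho1 z1; rewrite horner_poly.
have z0 : z != 0 by rewrite -modulus_eq0 z1 oner_eq0.
transitivity ((rho.[1])%:C%C : R[i]); last by rewrite rho1.
rewrite horner_coef rmorph_sum; apply: eq_bigr => k _.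
by rewrite -mulrA mulVf ?expf_neq0 // expr1n !mulr1.
Qed.

Lemma modulus_coefM_le P Q (S T : {poly R}) :
  (forall k, modulus P`_k <= S`_k) -> (forall k, modulus Q`_k <= T`_k) ->
  forall k, modulus (P * Q)`_k <= (S * T)`_k.
Proof.
move=> PS QT k; rewrite !coefM; apply: (le_trans (modulus_sum _ _ _)).
by apply: ler_sum => j _; rewrite modulusM ler_pM ?modulus_ge0.
Qed.

(** Adjoining a root turns [P] into [P + r - P * r], because [1 - P] gets multiplied by [1 - r]. The
    majorant follows the same recursion with every sign positive, which is the one of
    [(1 + rho)^d - 1]. Repeated entries of [s] account for multiple roots. *)
Lemma residual_majorant (s : seq R[i]) rho :
  (forall z, z \in s -> modulus z = 1) -> (forall k, 0 <= rho`_k) -> rho.[1] = 1 ->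
  exists P : {poly R[i]}, [/\ \prod_(z <- s) ('X - z%:P) %| 1 - P,
    (size P <= (size s * (size rho).-1).+1)%N &
    forall k, modulus P`_k <= ((1 + rho) ^+ size s - 1)`_k].
Proof.
move=> s1 rho0 rho1; elim: s s1 => [|z s IH] s1.
  exists 0; split=> [|| k]; rewrite ?big_nil ?subr0 ?dvdpp ?size_poly0 //.
  by rewrite expr0 subrr !coef0 modulus0.
have [P [dP sP mP]] := IH (fun y ys => s1 y (mem_behead (s := z :: s) ys)).
have z1 := s1 z (mem_head _ _).
set r := rotated rho z.
have mr k : modulus r`_k <= rho`_k by rewrite modulus_rotated.
exists (P + r - P * r); split.
- have -> : 1 - (P + r - P * r) = (1 - r) * (1 - P) by ring.
  rewrite big_cons dvdp_mul // dvdp_XsubCl /root !hornerE.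
  by rewrite (rotated_root rho1 z1) subrr.
- have sr : (size r <= (size rho).-1.+1)%N.
    by apply: (leq_trans (size_poly _ _)); rewrite leqSpred.
  rewrite /= mulSn; move: sP sr; move: (size rho).-1 (size s * _)%N => m q sP sr.
  apply: (leq_trans (size_polyD _ _)); rewrite geq_max size_polyN.
  apply/andP; split; last first.
    by apply: (leq_trans (size_polyMleq _ _)); move: (size P) (size r) sP sr => x y; lia.
  apply: (leq_trans (size_polyD _ _)); rewrite geq_max.
  by move: (size P) (size r) sP sr => x y; lia.
- move=> k.
  have -> : (1 + rho) ^+ size (z :: s) - 1 =
    (((1 + rho) ^+ size s - 1) + rho) + ((1 + rho) ^+ size s - 1) * rho.
    by rewrite exprS; ring.
  move: mP; move: (_ - 1) => S mP.
  rewrite coefB !coefD; apply: (le_trans (modulusB _ _)); apply: lerD.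
    by apply: (le_trans (modulusD _ _)); apply: lerD.
  exact: modulus_coefM_le.
Qed.

Lemma coef_expr1D_ge0 rho d k : (forall k, 0 <= rho`_k) -> 0 <= ((1 + rho) ^+ d)`_k.
Proof.
move=> rho0; elim: d k => [|d IH] k; first by rewrite expr0 coef1 ler0n.
rewrite exprS coefM; apply: sumr_ge0 => j _; apply: mulr_ge0 => //.
by rewrite coefD addr_ge0 // coef1 ler0n.
Qed.

(* The derivative of [(1 + rho) ^+ d] is [d (1 + rho) ^+ d.-1 rho'], whose first
   factor has coefficient sum [2 ^+ d.-1]. *)
Lemma coef_expr1D_le rho b d k : (forall k, 0 <= rho`_k) -> rho.[1] = 1 ->
  (forall k, k%:R * rho`_k <= b) ->
  k%:R * ((1 + rho) ^+ d)`_k <= d%:R * 2 ^+ d.-1 * b.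
Proof.
move=> rho0 rho1 rhob.
have b0 : 0 <= b by have := rhob 0%N; rewrite mul0r.
case: k => [|k]; first by rewrite mul0r !mulr_ge0 ?exprn_ge0 ?ler0n.
have -> : (k.+1%:R : R) * ((1 + rho) ^+ d)`_k.+1 =
    d%:R * ((1 + rho) ^+ d.-1 * rho^`())`_k.
  rewrite mulr_natl -coef_deriv deriv_exp derivD derivC add0r coefMn mulr_natl.
  by congr (_ *+ _); rewrite mulrC.
rewrite -mulrA ler_wpM2l ?ler0n // coefM.
have -> : (2 : R) ^+ d.-1 = ((1 + rho) ^+ d.-1).[1].
  by rewrite horner_exp !hornerE rho1.
set A := (1 + rho) ^+ d.-1.
have A0 j : 0 <= A`_j by apply: coef_expr1D_ge0.
rewrite (@horner_coef_wide _ (maxn (size A) k.+1)) ?leq_maxl // mulr_suml.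
apply: (@le_trans _ _ (\sum_(i < k.+1) A`_i * 1 ^+ i * b)).
  apply: ler_sum => i _; rewrite expr1n mulr1 ler_wpM2l //.
  by rewrite coef_deriv -mulr_natl.
rewrite -(big_mkord xpredT (fun i => A`_i * 1 ^+ i * b)).
rewrite -(big_mkord xpredT (fun i => A`_i * 1 ^+ i * b)).
rewrite [leRHS](@big_cat_nat _ _ _ k.+1) ?leq_maxr //=.
by rewrite lerDl sumr_ge0 // => i _; rewrite expr1n mulr1 mulr_ge0.
Qed.

Lemma closed_field_factor (f : {poly R[i]}) d : size f = d.+1 ->
  exists2 s : seq R[i], size s = d &
    f = lead_coef f *: \prod_(z <- s) ('X - z%:P).
Proof.
move=> sf; have [s fs] := closed_field_poly_normal f.
exists s => //; have := sf; rewrite {1}fs size_scale ?lead_coef_eq0 -?size_poly_gt0 ?sf //.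
by rewrite size_prod_XsubC => -[].
Qed.

Lemma approximant_exists (f : {poly R[i]}) d rho b n :
  size f = d.+1 -> (forall z, root f z -> modulus z = 1) ->
  (forall k, 0 <= rho`_k) -> rho.[1] = 1 -> (forall k, k%:R * rho`_k <= b) ->
  rho`_0 = 0 -> (d * (size rho).-1 <= n + d)%N ->
  exists Q : {poly R[i]}, [/\ (size Q <= n.+1)%N,
    (size (1 - Q * f)%R <= (n + d).+1)%N,
    forall k, modulus (1 - Q * f)`_k <= d%:R * 2 ^+ d * b / k.+1%:R &
    forall M k, (forall k, (k < M)%N -> rho`_k = 0) -> (k < M)%N ->
      (1 - Q * f)`_k = 0].
Proof.
move=> sf f1 rho0 rho1 rhob rho00 dn.
have [s ss fs] := closed_field_factor sf.
have f0 : f != 0 by rewrite -size_poly_gt0 sf.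
have lf0 : lead_coef f != 0 by rewrite lead_coef_eq0.
have [z zs|P [dP sP mP]] := @residual_majorant s rho _ rho0 rho1.
  by apply: f1; rewrite fs rootZ // root_prod_XsubC.
have fP : f %| 1 - P by rewrite fs dvdpZl.
have [Q PQ] := dvdpP _ _ fP; exists Q.
have EP : 1 - Q * f = P by rewrite -PQ; ring.
rewrite EP; rewrite ss in sP mP.
(* [(1 + rho)^d - 1] is a multiple of [rho], so it inherits the initial zeros of [rho]. *)
have low k : ((1 + rho) ^+ d - 1)`_k = (rho * \sum_(i < d) (1 + rho) ^+ i)`_k.
  by rewrite subrX1 [1 + rho - 1]addrAC subrr add0r.
have mP0 k : (forall j, (j <= k)%N -> rho`_j = 0) -> P`_k = 0.
  move=> rj; apply/eqP; rewrite -modulus_eq0 eq_le modulus_ge0 andbT.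
  apply: (le_trans (mP k)); rewrite low coefM big1 // => j _.
  by rewrite rj ?mul0r // -ltnS.
split.
- have [->|Q0] := eqVneq Q 0; first by rewrite size_poly0.
  have s1P : (size (1 - P)%R <= (n + d).+1)%N.
    apply: (leq_trans (size_polyD _ _)); rewrite size_polyN size_poly1 geq_max.
    by rewrite /= (leq_trans sP).
  by move: s1P; rewrite PQ size_mul // sf addnS /= -addSn leq_add2r.
- exact: leq_trans sP _.
- case=> [|k].
    rewrite mP0; last by move=> j; rewrite leqn0 => /eqP ->.
    have b0 : 0 <= b by have := rhob 0%N; rewrite mul0r.
    by rewrite modulus0 divr_ge0 ?mulr_ge0 ?exprn_ge0 ?ler0n.
  rewrite ler_pdivlMr ?ltr0n //.
  (* The derivative bound controls the index times the coefficient; passing to the index plus one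
     costs the factor 2 that turns [2 ^+ d.-1] into [2 ^+ d]. *)
  apply: (@le_trans _ _ (2 * (k.+1%:R * ((1 + rho) ^+ d)`_k.+1))).
    have := mP k.+1; rewrite coefB coef1 subr0 => h.
    rewrite mulrC mulrA ler_pM ?ler0n ?modulus_ge0 // -natrM ler_nat; lia.
  have := coef_expr1D_le d k.+1 rho0 rho1 rhob => /(ler_wpM2l (ler0n R 2)) /le_trans; apply.
  by case: (d) => [|e]; rewrite ?mul0r ?mulr0 //= [in leRHS]exprS; lra.
- by move=> M k rM kM; apply: mP0 => j jk; apply: rM; apply: leq_ltn_trans kM.
Qed.

End Majorant.

(** * Taylor coefficients *)

Lemma sum_nat_from (V : zmodType) (F : nat -> V) m n : (forall j, (j < m)%N -> F j = 0) ->
  (m < n)%N -> \sum_(0 <= j < n) F j = F m + \sum_(m.+1 <= j < n) F j.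
Proof.
move=> F0 mn; rewrite (@big_cat_nat _ _ _ m) ?(ltnW mn) //= [X in _ + X = _]big_ltn //.
rewrite big_nat big1 ?add0r // => j /andP[_]; exact: F0.
Qed.

Section Taylor.
Variable R : realType.
Implicit Types (a b : nat -> R[i]) (g h : disc_fun R) (P : {poly R[i]}).

(** Radii of balls in [R[i]^o] are positive elements of [R[i]]; these are real, so real radii
    suffice. *)
Lemma cvg_modulusP (u : nat -> R[i]) (l : R[i]) :
  u @ \oo --> (l : R[i]^o) <->
  forall e : R, 0 < e -> exists N, forall n, (N <= n)%N -> modulus (u n - l) < e.
Proof.
have H := @cvgrPdist_lt _ R[i]^o nat \oo _ u l.
split=> [/H {H} h e e0|h].
  have /h[N _ hN] : 0 < (e%:C%C : R[i]) by rewrite ltcR.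
  by exists N => n /hN; rewrite distrC normE ltcR.
apply/H => e e0.
have [r re] : exists r : R, e = r%:C%C.
  by apply/complex_realP/gtr0_real.
rewrite re ltcR in e0; have [N hN] := h _ e0.
by exists N => // n /= /hN; rewrite distrC normE re ltcR.
Qed.

Lemma norm_lt1 (z : R[i]) : (`|z| < 1) = (modulus z < 1).
Proof. exact: (ltcR _ 1). Qed.

Definition in_disc (z : R[i]) (z1 : modulus z < 1) : disc R :=
  exist (fun z : R[i] => `|z| < 1) z (etrans (norm_lt1 z) z1).

(** At a small real [t > 0] the first nonzero term [a m * t ^+ m] would outweigh the rest of the
    series, which then could not sum to 0. *)
Lemma taylor_zero a : is_taylor (fun=> 0) a -> forall k, a k = 0.
Proof.
move=> ta k; apply/eqP; apply: contraPT (ta) => ak0.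
have exm : exists k, a k != 0 by exists k.
set m := ex_minn exm; have am : a m != 0 by rewrite /m; case: ex_minnP.
have alt j : (j < m)%N -> a j = 0.
  rewrite /m; case: ex_minnP => i _ hi ji; apply/eqP; apply: contraTT ji => /hi.
  by rewrite -leqNgt.
move=> {}ta; have am0 : 0 < modulus (a m) by rewrite lt_def modulus_eq0 am modulus_ge0.
have half : modulus ((2^-1 : R)%:C%C) < 1.
  by rewrite modulus_real ?invr_ge0 //; lra.
(* Convergence at [1/2] bounds the terms there: from some rank on, consecutive partial sums differ
   by less than 2, and the finite sum covers the earlier terms. *)
have [B B0 HB] : exists2 B : R, 0 < B & forall j, modulus (a j) <= B * 2 ^+ j.
  have /cvg_modulusP/(_ 1 ltr01)[N hN] := ta (in_disc half).
  exists (2 + \sum_(0 <= j < N.+1) modulus (a j)).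
    by rewrite ltr_pwDl // sumr_ge0 // => i _; apply: modulus_ge0.
  move=> j; have P2 : 1 <= (2 : R) ^+ j by rewrite exprn_ege1 // ler1n.
  case: (leqP j N) => jN.
    apply: (@le_trans _ _ (\sum_(0 <= j < N.+1) modulus (a j))).
      rewrite (big_cat_nat _ _ (n := j)) //=; last exact: leqW.
      rewrite [X in _ <= _ + X]big_ltn // addrCA lerDl addr_ge0 ?sumr_ge0 // => *; exact: modulus_ge0.
    set S := \sum_(_ <= _ < _) _.
    have S0 : 0 <= S by rewrite sumr_ge0 // => *; exact: modulus_ge0.
    nra.
  have h1 := hN j (ltnW jN); have h2 := hN j.+1 (leqW (ltnW jN)).
  have : modulus (a j * ((2^-1 : R)%:C%C) ^+ j) < 2.
    have -> : a j * ((2^-1 : R)%:C%C) ^+ j =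
      (series (fun k => a k * ((2^-1 : R)%:C%C) ^+ k) j.+1 - 0) -
      (series (fun k => a k * ((2^-1 : R)%:C%C) ^+ k) j - 0).
      by rewrite /series /= big_nat_recr //=; ring.
    by apply: le_lt_trans (modulusB _ _) _; move: h1 h2 => /=; lra.
  rewrite modulusM modulusX modulus_real ?invr_ge0 // exprVn ltr_pdivrMr ?exprn_gt0 //.
  move=> /ltW/le_trans; apply; rewrite ler_wpM2r ?exprn_ge0 // lerDl sumr_ge0 // => *.
  exact: modulus_ge0.
(* The terms after [m] add up to at most [2 * B * (2 * t)^(m + 1)], because [t <= 1/4] keeps the
   geometric sum below 2. This equals [t^m * (t * D) / 2], hence is at most half of the term of
   index [m] once [t * D <= modulus (a m)]. *)
pose D := B * 2 ^+ m * 8.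
have D0 : 0 < D by rewrite !mulr_gt0 // exprn_gt0.
pose t : R := Num.min (4^-1) (modulus (a m) / D).
have t0 : 0 < t by rewrite lt_min invr_gt0 ltr0n divr_gt0.
have t4 : t <= 4^-1 by rewrite ge_min lexx.
have tD : t * D <= modulus (a m) by rewrite -ler_pdivlMr // ge_min lexx orbT.
have tl1 : modulus (t%:C%C) < 1.
  by rewrite modulus_real ?(ltW t0) //; lra.
have e0 : 0 < t ^+ m * modulus (a m) / 2 by rewrite divr_gt0 ?mulr_gt0 ?exprn_gt0.
have /cvg_modulusP/(_ _ e0)[N hN] := ta (in_disc tl1).
have := hN (m.+1 + N)%N (leq_addl _ _); apply/negP; rewrite -leNgt subr0 /series /=.
rewrite (@sum_nat_from _ (fun k => a k * t%:C%C ^+ k) m); first last.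
- by rewrite addSn ltnS leq_addr.
- by move=> j /alt ->; rewrite mul0r.
set T := \sum_(_ <= _ < _) _.
have hT : modulus T <= t ^+ m * modulus (a m) / 2.
  apply: (le_trans (modulus_sum _ _ _)).
  apply: (@le_trans _ _ (\sum_(m.+1 <= j < m.+1 + N) B * (2 * t) ^+ j)).
    apply: ler_sum => j _; rewrite modulusM modulusX modulus_real ?(ltW t0) //.
    by rewrite exprMn mulrA ler_wpM2r // exprn_ge0 // ltW.
  have -> : \sum_(m.+1 <= j < m.+1 + N) B * (2 * t) ^+ j =
     B * (2 * t) ^+ m.+1 * \sum_(0 <= j < N) (2 * t) ^+ j.
    rewrite -{1}[m.+1]add0n big_addn addKn mulr_sumr; apply: eq_bigr => j _.
    by rewrite exprD; ring.
  have geo : \sum_(0 <= j < N) (2 * t) ^+ j <= 2.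
    have : (1 - 2 * t) * \sum_(0 <= j < N) (2 * t) ^+ j <= 1.
      have -> : (1 - 2 * t) * \sum_(0 <= j < N) (2 * t) ^+ j = 1 - (2 * t) ^+ N.
        by rewrite -[RHS]opprB subrX1 big_mkord; ring.
      by rewrite gerBl exprn_ge0 // mulr_ge0 // ltW.
    set S := \sum_(_ <= _ < _) _.
    have : 0 <= S by rewrite sumr_ge0 // => *; rewrite exprn_ge0 //; lra.
    nra.
  apply: (@le_trans _ _ (B * (2 * t) ^+ m.+1 * 2)).
    rewrite ler_wpM2l // mulr_ge0 ?exprn_ge0 ?(ltW B0) //; lra.
  rewrite exprS exprMn.
  have := ler_wpM2l (exprn_ge0 m (ltW t0)) tD; rewrite /D; lra.
have := modulusD (a m * (t%:C%C) ^+ m + T) (- T); rewrite addrK modulusN.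
rewrite modulusM modulusX modulus_real ?(ltW t0) // => h; lra.
Qed.

Lemma cvg_linear (u v : nat -> R[i]) (l m c : R[i]) :
  u @ \oo --> (l : R[i]^o) -> v @ \oo --> (m : R[i]^o) ->
  (fun n => c * u n + v n) @ \oo --> (c * l + m : R[i]^o).
Proof.
move=> ul vm.
exact: (@cvgD _ R[i]^o nat \oo _ _ _ _ _ (@cvgMl_tmp _ nat \oo _ u c l ul) vm).
Qed.

Lemma is_taylor_linear g h a b c : is_taylor g a -> is_taylor h b ->
  is_taylor (fun z => c * g z + h z) (fun k => c * a k + b k).
Proof.
move=> ga hb z; have := @cvg_linear _ _ _ _ c (ga z) (hb z).
rewrite (_ : (fun n => _) = series (fun k => (c * a k + b k) * \val z ^+ k)) //.
apply/funext => n; rewrite /series /= mulr_sumr -big_split /=.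
by apply: eq_bigr => k _; ring.
Qed.

Lemma is_taylor_inj g a b : is_taylor g a -> is_taylor g b -> a = b.
Proof.
move=> ga gb; apply/funext => k; apply/eqP; rewrite -subr_eq0; apply/eqP.
have := taylor_zero (a := fun k => -1 * b k + a k) _ k; rewrite mulN1r addrC; apply.
have := @is_taylor_linear _ _ _ _ (-1) gb ga.
by rewrite (_ : (fun z => -1 * g z + g z) = fun=> 0) //; apply/funext => z; ring.
Qed.

Lemma taylorP g : analytic g -> is_taylor g (taylor g).
Proof. by case=> a ga; apply: (@xgetPex _ _ [set a | is_taylor g a]); exists a. Qed.

(** Uniqueness of expansions turns the choice made by [taylor] into a computation rule. *)
Lemma taylorE g a : is_taylor g a -> taylor g = a.
Proof. by move=> ga; apply: is_taylor_inj (ga); apply: taylorP; exists a. Qed.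

Lemma analytic_linear g h c : analytic g -> analytic h -> analytic (fun z => c * g z + h z).
Proof.
move=> [a ga] [b hb]; exists (fun k => c * a k + b k); exact: is_taylor_linear.
Qed.

Lemma taylor_linear g h c k : analytic g -> analytic h ->
  taylor (fun z => c * g z + h z) k = c * taylor g k + taylor h k.
Proof.
move=> /taylorP ga /taylorP hb.
by rewrite (taylorE (@is_taylor_linear _ _ _ _ c ga hb)).
Qed.

Lemma subfE g h : g \- h = fun z => -1 * h z + g z.
Proof. by apply/funext => z /=; ring. Qed.

Lemma analytic_sub g h : analytic g -> analytic h -> analytic (g \- h).
Proof. by rewrite subfE => ga ha; exact: analytic_linear. Qed.

Lemma taylor_sub g h k : analytic g -> analytic h ->
  taylor (g \- h) k = taylor g k - taylor h k.
Proof.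
move=> ga ha; rewrite subfE (taylor_linear (-1) k ha ga) mulN1r addrC; reflexivity.
Qed.

Definition shift_seq a : nat -> R[i] := fun k => if k is j.+1 then a j else 0.

Lemma series_shift_seq a (z : R[i]) n :
  series (fun k => shift_seq a k * z ^+ k) n.+1 = z * series (fun k => a k * z ^+ k) n.
Proof.
rewrite /series /= big_nat_recl //= mul0r add0r mulr_sumr.
by apply: eq_bigr => k _; rewrite exprS; ring.
Qed.

Lemma cvg_series_shift_seq a (z l : R[i]) :
  series (fun k => a k * z ^+ k) @ \oo --> (l : R[i]^o) ->
  series (fun k => shift_seq a k * z ^+ k) @ \oo --> (z * l : R[i]^o).
Proof.
move=> al; apply/cvg_modulusP => e e0.
have zal : (fun n => z * series (fun k => a k * z ^+ k) n) @ \oo --> (z * l : R[i]^o).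
  exact: (@cvgMl_tmp _ nat \oo _ _ z l al).
have /cvg_modulusP/(_ e e0)[N hN] := zal.
by exists N.+1 => -[//|n] /hN; rewrite series_shift_seq.
Qed.

Lemma is_taylor_shift g a : is_taylor g a -> is_taylor (shift g) (shift_seq a).
Proof. by move=> ga z; exact: cvg_series_shift_seq. Qed.

Lemma analytic_shift g : analytic g -> analytic (shift g).
Proof. by move=> [a ga]; exists (shift_seq a); exact: is_taylor_shift. Qed.

Lemma taylor_shift g : analytic g -> taylor (shift g) = shift_seq (taylor g).
Proof. by move=> /taylorP ga; apply: taylorE; exact: is_taylor_shift. Qed.

Lemma series_poly P (z : R[i]) n : (size P <= n)%N ->
  series (fun k => P`_k * z ^+ k) n = P.[z].
Proof. by move=> Pn; rewrite /series /= big_mkord (horner_coef_wide _ Pn). Qed.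

Lemma cvg_series_poly P (z : R[i]) :
  series (fun k => P`_k * z ^+ k) @ \oo --> (P.[z] : R[i]^o).
Proof.
apply/cvg_modulusP => e e0; exists (size P) => n Pn.
by rewrite series_poly // subrr modulus0.
Qed.

Lemma is_taylor_poly P : is_taylor (poly_fun P) (fun k => P`_k).
Proof. by move=> z; exact: cvg_series_poly. Qed.

Lemma analytic_poly P : analytic (poly_fun P).
Proof. by exists (fun k => P`_k); exact: is_taylor_poly. Qed.

Lemma taylor_poly P : taylor (poly_fun P) = fun k => P`_k.
Proof. by apply: taylorE; exact: is_taylor_poly. Qed.

End Taylor.

(** * Norms of coefficient sequences *)

Section NormBounds.
Variable R : realType.
Implicit Types (a b : nat -> R[i]) (g h : disc_fun R) (P Q : {poly R[i]}).
Implicit Types (p : \bar R) (r alpha e : R).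

(** Expresses a norm bound through real partial sums, or through single terms for the supremum norm,
    so that estimates involve neither infinite sums nor roots. *)
Definition bounded_by p alpha e a : Prop :=
  match p with
  | r%:E => forall N, \sum_(0 <= k < N) modulus (a k) `^ r * k.+1%:R `^ alpha <= e `^ r
  | _ => forall k, modulus (a k) * k.+1%:R `^ alpha <= e
  end.

Lemma weight_ge0 r alpha a k : 0 <= modulus (a k) `^ r * k.+1%:R `^ alpha.
Proof. by rewrite mulr_ge0 ?powR_ge0. Qed.

Lemma nneseries_leP (u : nat -> R) (B : R) : (forall k, 0 <= u k) ->
  (\sum_(0 <= k <oo) (u k)%:E <= B%:E)%E <-> forall N, \sum_(0 <= k < N) u k <= B.
Proof.
move=> u0; split=> [h N|h].
  rewrite -lee_fin; apply: le_trans h; rewrite -sumEFin.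
  by apply: nneseries_lim_ge => k _ _; rewrite lee_fin.
apply: lime_le; first by apply: is_cvg_nneseries => k _ _; rewrite lee_fin.
by apply: nearW => N; rewrite sumEFin lee_fin.
Qed.

Lemma poweR_le_iff (S : \bar R) r e : 0 < r -> 0 <= e -> (0 <= S)%E ->
  (poweR S r^-1 <= e%:E)%E <-> (S <= (e `^ r)%:E)%E.
Proof.
move=> r0 e0; have ri0 : 0 < r^-1 by rewrite invr_gt0.
case: S => [s||] //; last first.
  by move=> _; rewrite poweRyr ?gt_eqF // !leye_eq.
rewrite poweR_EFin !lee_fin => s0; split=> h.
  have := ge0_ler_powR (ltW r0) _ _ h; rewrite !nnegrE powR_ge0 e0 => /(_ isT isT).
  by rewrite -powRrM mulVf ?gt_eqF // powRr1.
have := ge0_ler_powR (ltW ri0) _ _ h; rewrite !nnegrE powR_ge0 s0 => /(_ isT isT).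
by rewrite -powRrM mulfV ?gt_eqF // powRr1.
Qed.

Lemma lnorm_leP p alpha g e : (1 <= p)%E -> 0 <= e ->
  (lnorm p alpha g <= e%:E)%E <-> bounded_by p alpha e (taylor g).
Proof.
case: p => [r||] //; rewrite ?lee_fin => p1 e0 /=.
  rewrite poweR_le_iff //; last 2 first.
  - exact: lt_le_trans p1.
  - by apply: nneseries_ge0 => k _ _; rewrite lee_fin weight_ge0.
  by rewrite nneseries_leP // => k; exact: weight_ge0.
split=> [h k|h].
  by rewrite -lee_fin; apply: le_trans h; apply: ereal_sup_ubound; exists k.
by apply: ge_ereal_sup => _ [k _ <-]; rewrite lee_fin.
Qed.

Lemma lnorm_ge0 p alpha g : (1 <= p)%E -> (0 <= lnorm p alpha g)%E.
Proof.
case: p => [r||] //= _; first exact: poweR_ge0.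
apply: (@le_trans _ _ (modulus (taylor g 0%N) * 1%:R `^ alpha)%:E).
  by rewrite lee_fin mulr_ge0 ?modulus_ge0 ?powR_ge0.
by apply: ereal_sup_ubound; exists 0%N.
Qed.

Lemma lnorm_ltyP p alpha g : (1 <= p)%E ->
  (lnorm p alpha g < +oo)%E <-> exists2 e, 0 < e & bounded_by p alpha e (taylor g).
Proof.
move=> p1; split=> [h|[e e0 /(lnorm_leP _ _ p1 (ltW e0)) h]]; last first.
  exact: le_lt_trans (ltry e).
have : lnorm p alpha g \is a fin_num by rewrite ge0_fin_numE // lnorm_ge0.
move=> /fineK lE; exists (`|fine (lnorm p alpha g)| + 1).
  by rewrite ltr_wpDl.
apply/(lnorm_leP _ _ p1 (addr_ge0 (normr_ge0 _) ler01)).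
by rewrite -lE lee_fin /=; apply: (le_trans (ler_norm _)); rewrite lerDl.
Qed.

Lemma bounded_by_scale p alpha e a (c : R[i]) : (1 <= p)%E -> 0 < e ->
  bounded_by p alpha e a -> bounded_by p alpha (modulus c * e) (fun k => c * a k).
Proof.
case: p => [r||] //= _ e0 h n; last first.
  by rewrite modulusM -mulrA ler_wpM2l ?modulus_ge0.
rewrite powRM ?modulus_ge0 ?(ltW e0) //.
under eq_bigr do rewrite modulusM powRM ?modulus_ge0 // -mulrA.
by rewrite -mulr_sumr ler_wpM2l ?powR_ge0.
Qed.

(* A quasi-triangle inequality, enough for every closure argument below. *)
Lemma bounded_by_add p alpha e e' a b : (1 <= p)%E -> 0 < e -> 0 < e' ->
  bounded_by p alpha e a -> bounded_by p alpha e' b ->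
  bounded_by p alpha (4 * (e + e')) (fun k => a k + b k).
Proof.
case: p => [r||] //=; rewrite ?lee_fin => p1 e0 e0' ha hb n; last first.
  apply: (@le_trans _ _ (modulus (a n) * n.+1%:R `^ alpha + modulus (b n) * n.+1%:R `^ alpha)).
    by rewrite -mulrDl ler_wpM2r ?powR_ge0 ?modulusD.
  have := ha n; have := hb n; lra.
have r0 : 0 <= r by lra.
apply: (@le_trans _ _ (\sum_(0 <= k < n) 2 `^ r * (modulus (a k) `^ r * k.+1%:R `^ alpha +
   modulus (b k) `^ r * k.+1%:R `^ alpha))).
  apply: ler_sum => k _; rewrite -mulrDl mulrA ler_wpM2r ?powR_ge0 //.
  have a0 := modulus_ge0 (a k); have b0 := modulus_ge0 (b k).
  wlog ab : a b {ha hb} a0 b0 / modulus (b k) <= modulus (a k).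
    move=> H; have [ab|/ltW ab] := lerP (modulus (b k)) (modulus (a k)); first exact: H.
    by rewrite addrC [X in _ * X]addrC; exact: (H b a).
  apply: (@le_trans _ _ ((2 * modulus (a k)) `^ r)).
    apply: ge0_ler_powR; rewrite ?nnegrE ?modulus_ge0 ?mulr_ge0 //.
    by apply: (le_trans (modulusD _ _)); lra.
  by rewrite powRM // ler_wpM2l ?powR_ge0 // lerDl powR_ge0.
rewrite -mulr_sumr big_split /=.
apply: (@le_trans _ _ (2 `^ r * ((e + e') `^ r + (e + e') `^ r))).
  rewrite ler_wpM2l ?powR_ge0 //; apply: lerD.
    by apply: (le_trans (ha n)); apply: ge0_ler_powR; rewrite ?nnegrE; lra.
  by apply: (le_trans (hb n)); apply: ge0_ler_powR; rewrite ?nnegrE; lra.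
have -> : (4 * (e + e')) `^ r = 2 `^ r * (2 `^ r * (e + e') `^ r).
  rewrite -!powRM //; try lra; congr (_ `^ _); ring.
rewrite ler_wpM2l ?powR_ge0 // -[leLHS]mulr2n -[leLHS]mulr_natl ler_wpM2r ?powR_ge0 //.
by rewrite -[leLHS]powRr1 // ler_powR // (ler_nat R 1).
Qed.

(** The ratio of consecutive bases lies between 1 and 2; the absolute value of the exponent covers
    both signs of [alpha]. *)
Lemma powR_shift_le alpha k :
  (k.+2%:R : R) `^ alpha <= 2 `^ `|alpha| * k.+1%:R `^ alpha.
Proof.
have -> : (k.+2%:R : R) = (k.+2%:R / k.+1%:R) * k.+1%:R by rewrite divfK // pnatr_eq0.
rewrite powRM ?divr_ge0 // ler_wpM2r ?powR_ge0 //.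
have q1 : 1 <= k.+2%:R / k.+1%:R :> R by rewrite ler_pdivlMr ?ltr0n // mul1r ler_nat.
apply: (@le_trans _ _ ((k.+2%:R / k.+1%:R) `^ `|alpha|)).
  by apply: ler_powR => //; exact: ler_norm.
apply: ge0_ler_powR; rewrite ?nnegrE ?divr_ge0 //.
rewrite ler_pdivrMr ?ltr0n // -natrM ler_nat; lia.
Qed.

Lemma bounded_by_shift p alpha e a : (1 <= p)%E -> 0 < e ->
  bounded_by p alpha e a -> bounded_by p alpha (2 `^ `|alpha| * e) (shift_seq a).
Proof.
(* A constant that is at least 1 is bounded by its own power [r >= 1], so the same factor serves
   every exponent. *)
have P1 : 1 <= 2 `^ `|alpha| :> R.
  by rewrite -[leLHS](powRr0 2) ler_powR // (ler_nat R 1).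
case: p => [r||] //=; rewrite ?lee_fin => p1 e0 h [|n].
- by rewrite big_geq // powR_ge0.
- rewrite big_nat_recl // [modulus (shift_seq a 0)]modulus0 powR0 ?mul0r ?add0r; last by lra.
  apply: (@le_trans _ _ (\sum_(0 <= k < n) 2 `^ `|alpha| *
      (modulus (a k) `^ r * k.+1%:R `^ alpha))).
    apply: ler_sum => k _; rewrite mulrCA ler_wpM2l ?powR_ge0 //.
    exact: powR_shift_le.
  rewrite -mulr_sumr powRM ?powR_ge0 ?(ltW e0) //.
  apply: ler_pM; rewrite ?powR_ge0 ?sumr_ge0 // => *; rewrite ?weight_ge0 //.
  by rewrite -[leLHS]powRr1 ?powR_ge0 // ler_powR.
- by rewrite modulus0 mul0r mulr_ge0 ?powR_ge0 // ltW.
- apply: (@le_trans _ _ (2 `^ `|alpha| * (modulus (a n) * n.+1%:R `^ alpha))).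
    by rewrite mulrCA ler_wpM2l ?modulus_ge0 // powR_shift_le.
  by rewrite ler_wpM2l ?powR_ge0.
Qed.

Lemma bounded_by_poly p alpha P : (1 <= p)%E ->
  exists2 e, 0 < e & bounded_by p alpha e (fun k => P`_k).
Proof.
case: p => [r||] //=; rewrite ?lee_fin => p1.
  set S := \sum_(0 <= k < size P) modulus P`_k `^ r * k.+1%:R `^ alpha.
  have S0 : 0 <= S by rewrite sumr_ge0 // => *; rewrite weight_ge0.
  exists ((1 + S) `^ r^-1); first by rewrite powR_gt0; lra.
  move=> N; rewrite -powRrM mulVf ?powRr1; try lra.
  apply: (@le_trans _ _ S); last by lra.
  have [NP|PN] := leqP N (size P).
    rewrite /S [leRHS](@big_cat_nat _ _ _ N) //= lerDl sumr_ge0 // => *.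
    by rewrite weight_ge0.
  rewrite (@big_cat_nat _ _ _ (size P)) ?(ltnW PN) //= big_nat [X in _ + X]big_nat.
  rewrite [X in _ + X]big1 ?addr0 -?big_nat // => k /andP[Pk _].
  by rewrite nth_default // modulus0 powR0 ?mul0r //; lra.
set S := \sum_(0 <= k < size P) modulus P`_k * k.+1%:R `^ alpha.
have S0 : 0 <= S by rewrite sumr_ge0 // => *; rewrite mulr_ge0 ?powR_ge0 ?modulus_ge0.
exists (1 + S); first lra; move=> k; apply: (@le_trans _ _ S); last by lra.
have [kP|Pk] := ltnP k (size P); last by rewrite nth_default // modulus0 mul0r.
rewrite /S (@big_cat_nat _ _ _ k) ?(ltnW kP) //= [X in _ + X]big_ltn // addrCA lerDl.
by rewrite addr_ge0 ?sumr_ge0 // => *; rewrite mulr_ge0 ?powR_ge0 ?modulus_ge0.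
Qed.

Lemma lspace_poly p alpha P : (1 <= p)%E -> lspace p alpha (poly_fun P).
Proof.
move=> p1; split; first exact: analytic_poly.
by apply/lnorm_ltyP => //; rewrite taylor_poly; exact: bounded_by_poly.
Qed.

Lemma lspace_linear p alpha c g h : (1 <= p)%E -> lspace p alpha g -> lspace p alpha h ->
  lspace p alpha (fun z => c * g z + h z).
Proof.
move=> p1 [ga /lnorm_ltyP] /(_ p1) [e e0 he] [ha /lnorm_ltyP] /(_ p1)[e' e0' he'].
split; first exact: analytic_linear.
apply/lnorm_ltyP => //.
have -> : taylor (fun z => c * g z + h z) = fun k => c * taylor g k + taylor h k.
  by apply/funext => k; exact: taylor_linear.
case: (eqVneq c 0) => [->|c0].
  exists e' => //; rewrite (_ : (fun k => _) = taylor h) //.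
  by apply/funext => k; rewrite mul0r add0r.
have ce : 0 < modulus c * e by rewrite mulr_gt0 // lt_def modulus_eq0 c0 modulus_ge0.
exists (4 * (modulus c * e + e')); first by rewrite mulr_gt0 ?addr_gt0.
by apply: bounded_by_add => //; exact: bounded_by_scale.
Qed.

Lemma lspace_shift p alpha g : (1 <= p)%E -> lspace p alpha g -> lspace p alpha (shift g).
Proof.
move=> p1 [ga /lnorm_ltyP] /(_ p1) [e e0 he]; split; first exact: analytic_shift.
apply/lnorm_ltyP => //; exists (2 `^ `|alpha| * e); first by rewrite mulr_gt0 ?powR_gt0.
by rewrite taylor_shift //; exact: bounded_by_shift.
Qed.

Lemma lspace_invariant p alpha : (1 <= p)%E -> invariant_subspace p alpha (lspace p alpha).
Proof.
move=> p1; split.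
- exact: subset_refl.
- rewrite (_ : (fun=> 0) = poly_fun (0 : {poly R[i]})); first exact: lspace_poly.
  by apply/funext => z; rewrite /poly_fun horner0.
- by move=> c g h; exact: lspace_linear.
- by move=> g; exact: lspace_shift.
Qed.

End NormBounds.

(** * Density of the polynomials *)

Section Series.
Variable R : realType.

(** Cut at a partial sum that is within [e] of the supremum of all partial sums. *)
Lemma bounded_sum_tail (u : nat -> R) (B e : R) : (forall k, 0 <= u k) ->
  (forall N, \sum_(0 <= k < N) u k <= B) -> 0 < e ->
  exists n, forall N, \sum_(n <= k < N) u k <= e.
Proof.
move=> u0 uB e0; pose S := range (fun N => \sum_(0 <= k < N) u k).
have supS : has_sup S.
  by split; [exists (\sum_(0 <= k < 0) u k), 0%N | exists B => _ [N _ <-]].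
have [_ [n _ <-] hn] := sup_adherent e0 supS.
exists n => N; have [Nn|nN] := leqP N n; first by rewrite big_geq // ltW.
have : \sum_(0 <= k < N) u k <= sup S by apply: sup_upper_bound => //; exists N.
rewrite (@big_cat_nat _ _ _ n) ?(ltnW nN) //=.
by move: hn; move: (sup S) (\sum_(0 <= k < n) u k) (\sum_(n <= k < N) u k) => x y z; lra.
Qed.

Lemma sum_from_le (u v : nat -> R) n (B : R) : (forall k, (k < n)%N -> u k = 0) ->
  (forall k, (n <= k)%N -> u k <= v k) ->
  (forall N, \sum_(n <= k < N) v k <= B) -> forall N, \sum_(0 <= k < N) u k <= B.
Proof.
move=> u0 uv vB N; have [Nn|nN] := leqP N n.
  have := vB 0%N; rewrite big_geq // big_nat big1 // => k /andP[_ kN].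
  by rewrite u0 // (leq_trans kN).
apply: le_trans (vB N); rewrite (@big_cat_nat _ _ _ n) ?(ltnW nN) //=.
rewrite big_nat [X in X + _]big1 ?add0r.
  by rewrite big_nat [leRHS]big_nat; apply: ler_sum => k /andP[/uv].
by move=> k /andP[_ /u0].
Qed.

Lemma cvg_series_bounded (u : nat -> R) (B : R) :
  (forall N, \sum_(0 <= k < N) `|u k| <= B) -> cvgn (series u).
Proof.
move=> uB; apply: normed_cvg; apply: nondecreasing_is_cvgn.
  by apply: nondecreasing_series => k _ _ /=.
by exists B => _ [N _ <-]; exact: uB.
Qed.

Lemma modulus_ge_Re (z : R[i]) : `|complex.Re z| <= modulus z.
Proof. by rewrite -lecR; exact: normc_ge_Re. Qed.

Lemma modulus_ge_Im (z : R[i]) : `|complex.Im z| <= modulus z.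
Proof.
case: z => a b /=; rewrite -[leLHS]ger0_norm // -sqrtr_sqr ler_wsqrtr //.
by rewrite real_normK ?num_real // lerDr sqr_ge0.
Qed.

Lemma modulus_le_Re_Im (z : R[i]) : modulus z <= `|complex.Re z| + `|complex.Im z|.
Proof.
case: z => a b /=; rewrite -[leRHS]ger0_norm ?addr_ge0 // -sqrtr_sqr ler_wsqrtr //.
by rewrite sqrrD !real_normK ?num_real // addrAC lerDl mulrn_wge0 ?mulr_ge0.
Qed.

Lemma Re_sum n (F : nat -> R[i]) :
  complex.Re (\sum_(0 <= k < n) F k) = \sum_(0 <= k < n) complex.Re (F k).
Proof. by elim/big_rec2 : _ => // k y x _ <-; case: x (F k) => ? ? []. Qed.

Lemma Im_sum n (F : nat -> R[i]) :
  complex.Im (\sum_(0 <= k < n) F k) = \sum_(0 <= k < n) complex.Im (F k).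
Proof. by elim/big_rec2 : _ => // k y x _ <-; case: x (F k) => ? ? []. Qed.

Lemma complex_series_bounded (u : nat -> R[i]) (B : R) :
  (forall N, \sum_(0 <= k < N) modulus (u k) <= B) ->
  exists2 l : R[i], series u @ \oo --> (l : R[i]^o) & modulus l <= B.
Proof.
move=> uB.
have cRe : cvgn (series (fun k => complex.Re (u k))).
  apply: (@cvg_series_bounded _ B) => N; apply: le_trans (uB N).
  by apply: ler_sum => k _; exact: modulus_ge_Re.
have cIm : cvgn (series (fun k => complex.Im (u k))).
  apply: (@cvg_series_bounded _ B) => N; apply: le_trans (uB N).
  by apply: ler_sum => k _; exact: modulus_ge_Im.
pose l := (limn (series (fun k => complex.Re (u k))) +i*
           limn (series (fun k => complex.Im (u k))))%C.
have ul : series u @ \oo --> (l : R[i]^o).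
  apply/cvg_modulusP => e e0; have e2 : 0 < e / 2 by rewrite divr_gt0.
  have /cvgrPdist_lt/(_ _ e2)[N1 _ h1] := cRe.
  have /cvgrPdist_lt/(_ _ e2)[N2 _ h2] := cIm.
  exists (maxn N1 N2) => n; rewrite geq_max => /andP[/h1 /= n1 /h2 /= n2].
  apply: (le_lt_trans (modulus_le_Re_Im _)).
  have -> : series u n - l = ((series (fun k => complex.Re (u k)) n - complex.Re l) +i*
      (series (fun k => complex.Im (u k)) n - complex.Im l))%C.
    by rewrite /series /= -Re_sum -Im_sum; case: (\sum_(_ <= _ < _) _).
  rewrite /= distrC [X in _ + X]distrC; lra.
exists l => //; apply/ler_addgt0Pr => e e0.
have /cvg_modulusP/(_ e e0)[N hN] := ul.
have -> : l = series u N - (series u N - l) by ring.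
apply: (le_trans (modulusB _ _)); apply: lerD; last exact: ltW (hN N (leqnn N)).
exact: le_trans (modulus_sum _ _ _) (uB N).
Qed.

End Series.

(** * Small residuals and dense polynomials, in the norm and weak-star senses *)

Section Cyclicity.
Variable R : realType.
Implicit Types (a b : nat -> R[i]) (g h : disc_fun R) (f P Q : {poly R[i]}).
Implicit Types (p : \bar R) (r alpha e : R) (M : set (disc_fun R)).
Implicit Types (cl : set (disc_fun R) -> set (disc_fun R)).

Lemma lnorm_lt p alpha g e e' : (1 <= p)%E -> 0 <= e' -> e' < e ->
  bounded_by p alpha e' (taylor g) -> (lnorm p alpha g < e%:E)%E.
Proof.
by move=> p1 e0 ee /(lnorm_leP _ _ p1 e0) h; apply: (le_lt_trans h); rewrite lte_fin.
Qed.

(** Horner's scheme: [(P * 'X + c) * f] is [c * f] plus the shift of [P * f]. *)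
Lemma invariant_mul_poly p alpha M f P : invariant_subspace p alpha M ->
  M (poly_fun f) -> M (poly_fun (P * f)).
Proof.
move=> [_ M0 Mlin Mshift] Mf; elim/poly_ind: P => [|P c IH].
  rewrite mul0r (_ : poly_fun 0 = fun=> 0) //.
  by apply/funext => z; rewrite /poly_fun horner0.
rewrite (_ : poly_fun ((P * 'X + c%:P) * f) =
  fun z => c * poly_fun f z + shift (poly_fun (P * f)) z).
  by apply: Mlin => //; exact: Mshift.
apply/funext => z; rewrite /poly_fun /shift !hornerM hornerD hornerM hornerX hornerC; ring.
Qed.

Lemma generated_invariant_sub p alpha cl f M : invariant_subspace p alpha M ->
  cl M `<=` M -> M (poly_fun f) -> generated p alpha cl (poly_fun f) `<=` M.
Proof. by move=> Mi Mc Mf; apply: smallest_sub => // _ ->. Qed.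

Lemma sub_polyE P Q : poly_fun P \- poly_fun Q = poly_fun (P - Q).
Proof. by apply/funext => z; rewrite /poly_fun /= hornerD hornerN. Qed.

Lemma polys_of_residuals p alpha M f : (1 <= p)%E -> invariant_subspace p alpha M ->
  norm_closure p alpha M `<=` M -> M (poly_fun f) ->
  (forall e, 0 < e -> exists Q, (residual_norm p alpha f Q < e%:E)%E) ->
  forall P, M (poly_fun P).
Proof.
move=> p1 Mi Mc Mf res P; rewrite -[P]mulr1; apply: (invariant_mul_poly _ Mi).
apply: Mc; split; first exact: lspace_poly.
move=> e /res[Q hQ]; exists (poly_fun (Q * f)); first exact: (invariant_mul_poly _ Mi).
by rewrite sub_polyE.
Qed.

Definition truncation g n : {poly R[i]} := \poly_(k < n) taylor g k.

Lemma taylor_sub_truncation g n k : analytic g ->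
  taylor (g \- poly_fun (truncation g n)) k = if (k < n)%N then 0 else taylor g k.
Proof.
move=> ga; rewrite (taylor_sub _ ga (analytic_poly _)) taylor_poly coef_poly.
by case: ifP => _; rewrite ?subrr ?subr0.
Qed.

(** Truncations converge because the norm is a convergent series. A supremum norm has no small
    tails, so that case goes through the predual instead. *)
Lemma polys_dense r alpha M g : 1 <= r -> (forall P, M (poly_fun P)) ->
  lspace r%:E alpha g -> norm_closure r%:E alpha M g.
Proof.
move=> r1 MP gl; split => // e e0; have [ga /lnorm_ltyP] := gl.
rewrite lee_fin => /(_ r1) [B _ hB].
have e2 : 0 < e / 2 by rewrite divr_gt0.
have [n hn] := bounded_sum_tail (weight_ge0 r alpha (taylor g)) hB
  (powR_gt0 r e2).
exists (poly_fun (truncation g n)) => //.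
have e1 : e / 2 < e by lra.
have r1' : (1%:E <= r%:E)%E by rewrite lee_fin.
apply: (@lnorm_lt r%:E alpha _ _ _ r1' (ltW e2) e1).
apply: (sum_from_le _ _ hn) => k kn; rewrite (taylor_sub_truncation _ _ ga).
  by rewrite kn modulus0 powR0 ?mul0r // gt_eqF; lra.
by rewrite ltnNge kn.
Qed.

Lemma predualP alpha b : predual alpha b ->
  exists2 B : R, 0 < B & forall N, \sum_(0 <= k < N) modulus (b k) * k.+1%:R `^ (- alpha) <= B.
Proof.
rewrite /predual; set S := (\sum_(_ <= _ <oo) _)%E => hS.
have t0 k : 0 <= modulus (b k) * k.+1%:R `^ (- alpha).
  by rewrite mulr_ge0 ?powR_ge0 ?modulus_ge0.
have S0 : (0 <= S)%E by apply: nneseries_ge0 => k _ _; rewrite lee_fin.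
have Sf : S \is a fin_num by rewrite ge0_fin_numE.
exists (fine S + 1); first by rewrite ltr_wpDl // fine_ge0.
move=> N; apply: (@le_trans _ _ (fine S)); last by rewrite lerDl.
by move: N; apply/nneseries_leP => //; rewrite fineK.
Qed.

(** Makes evaluation at a point of the unit circle a weak-star continuous functional. *)
Lemma predual_unimodular alpha (z : R[i]) : 1 < alpha -> modulus z = 1 ->
  predual alpha (fun k => z ^+ k).
Proof.
move=> a1 z1; have [C C0 hC] := sum_powRN_bounded a1.
apply: (@le_lt_trans _ _ C%:E); last exact: ltry.
apply/nneseries_leP => [k|N]; first by rewrite mulr_ge0 ?powR_ge0 ?modulus_ge0.
by under eq_bigr do rewrite modulusX z1 expr1n mul1r.
Qed.

(** Serves two purposes: with [n = 0] and [e] small it shows that norm approximation implies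
    weak-star approximation; with [e] fixed and [B] a small tail it handles truncations. *)
Lemma pairing_small alpha e B a b n : 0 <= e ->
  (forall k, (k < n)%N -> a k = 0) -> bounded_by +oo%E alpha e a ->
  (forall N, \sum_(n <= k < N) modulus (b k) * k.+1%:R `^ (- alpha) <= B) ->
  exists2 l : R[i], series (fun k => a k * b k) @ \oo --> (l : R[i]^o) & modulus l <= e * B.
Proof.
move=> e0 a0 ha hb; apply: complex_series_bounded => N.
have ab k : modulus (a k * b k) <= e * (modulus (b k) * k.+1%:R `^ (- alpha)).
  rewrite modulusM mulrCA mulrC ler_wpM2l ?modulus_ge0 //.
  by rewrite powRN ler_pdivlMr ?powR_succ_gt0.
move: N; apply: (@sum_from_le _ _ _ n _ _ (fun k _ => ab k)) => [k kn|N].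
  by rewrite a0 // mul0r modulus0.
by rewrite -mulr_sumr ler_wpM2l.
Qed.

(** Each [T j] holds from some bound on, so the sum of the bounds works for all [j]; the added 1
    keeps it positive when [m = 0]. *)
Lemma uniform_choice m (T : 'I_m -> R -> Prop) : 
  (forall j, exists2 B, 0 < B & forall B', B <= B' -> T j B') ->
  exists2 B, 0 < B & forall j, T j B.
Proof.
move=> h; pose B j := s2val (cid2 (h j)).
have B0 j : 0 < B j by rewrite /B; case: cid2.
have BT j B' : B j <= B' -> T j B' by rewrite /B; case: cid2 => ? ? /= H /H.
exists (1 + \sum_j B j); first by rewrite ltr_pwDl // sumr_ge0 // => j _; rewrite ltW.
move=> j; apply: BT; rewrite (bigD1 j) //= addrCA lerDl addr_ge0 // sumr_ge0 // => i _.
exact: ltW.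
Qed.

Lemma norm_sub_weak_star alpha M P : lspace +oo%E alpha (poly_fun P) ->
  (forall e, 0 < e -> exists2 Q, M (poly_fun Q) &
     (lnorm +oo%E alpha (poly_fun (P - Q)) < e%:E)%E) ->
  weak_star_closure alpha M (poly_fun P).
Proof.
move=> Pl H; split=> // m b e e0 hb.
have [B B0 hB] : exists2 B, 0 < B & forall j : 'I_m, forall N,
    \sum_(0 <= k < N) modulus (b j k) * k.+1%:R `^ (- alpha) <= B.
  apply: (@uniform_choice m (fun j B => forall N, \sum_(0 <= k < N) _ <= B)) => j.
  have [B B0 hB] := predualP (hb j); exists B => // B' BB' N.
  exact: le_trans (hB N) BB'.
have e1 : 0 < e / (2 * B) by rewrite divr_gt0 ?mulr_gt0.
have [Q MQ hQ] := H _ e1; exists (poly_fun Q) => // j.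
have p1 : (1 <= +oo :> \bar R)%E by rewrite leey.
have := (lnorm_leP alpha (poly_fun (P - Q)) p1 (ltW e1)).1 (ltW hQ) => bd.
have [l hl le] := @pairing_small alpha _ B _ (b j) 0%N (ltW e1) (fun k => ltac:(by [])) bd (hB j).
exists l; first by rewrite sub_polyE.
apply: (le_lt_trans le); rewrite invfM mulrA divfK ?gt_eqF //; lra.
Qed.

(** What is left after truncation keeps the norm bound [G] of [g], while the finitely many test
    sequences have small tails in the predual norm. *)
Lemma polys_weak_star_dense alpha M g : (forall P, M (poly_fun P)) ->
  lspace +oo%E alpha g -> weak_star_closure alpha M g.
Proof.
move=> MP gl; split=> // m b e e0 hb; have [ga /lnorm_ltyP] := gl.
have p1 : (1 <= +oo :> \bar R)%E by rewrite leey.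
move=> /(_ p1)[G G0 hG]; have e1 : 0 < e / (2 * G) by rewrite divr_gt0 ?mulr_gt0.
have ex j : exists n, forall N,
    \sum_(n <= k < N) modulus (b j k) * k.+1%:R `^ (- alpha) <= e / (2 * G).
  have [B _ hB] := predualP (hb j); apply: bounded_sum_tail hB e1 => k.
  by rewrite mulr_ge0 ?powR_ge0 ?modulus_ge0.
have [n hn] := choice ex; pose n0 := (\max_(j < m) n j)%N.
exists (poly_fun (truncation g n0)) => // j.
have low k : (k < n j)%N -> taylor (g \- poly_fun (truncation g n0)) k = 0.
  move=> kn; rewrite (taylor_sub_truncation _ _ ga) (leq_trans kn) //.
  exact: (leq_bigmax j).
have bd : bounded_by +oo%E alpha G (taylor (g \- poly_fun (truncation g n0))).
  move=> k; rewrite (taylor_sub_truncation _ _ ga); case: ifP => _; last exact: hG.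
  by rewrite modulus0 mul0r ltW.
have [l hl le] := pairing_small (ltW G0) low bd (hn j).
exists l => //; apply: (le_lt_trans le).
have -> : G * (e / (2 * G)) = e / 2 by field; rewrite gt_eqF.
lra.
Qed.

End Cyclicity.

(** * Closed invariant subspaces *)

Section Closures.
Variable R : realType.
Implicit Types (a b : nat -> R[i]) (g h : disc_fun R) (f P Q : {poly R[i]}).
Implicit Types (p : \bar R) (r alpha e : R) (M : set (disc_fun R)).
Implicit Types (cl : set (disc_fun R) -> set (disc_fun R)).

Lemma bounded_by_le p alpha e e' a : (1 <= p)%E -> 0 < e -> e <= e' ->
  bounded_by p alpha e a -> bounded_by p alpha e' a.
Proof.
case: p => [r||] //=; rewrite ?lee_fin => p1 e0 ee h n; apply: (le_trans (h n)) => //.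
by apply: ge0_ler_powR; rewrite ?nnegrE; lra.
Qed.

Lemma poly_in_norm_closure p alpha M P : (1 <= p)%E -> M (poly_fun P) ->
  norm_closure p alpha M (poly_fun P).
Proof.
move=> p1 MP; split; first exact: lspace_poly.
move=> e e0; exists (poly_fun P); first exact: MP.
rewrite sub_polyE subrr.
have e2 : 0 < e / 2 by lra.
have e3 : e / 2 < e by lra.
apply: (@lnorm_lt _ p alpha _ _ _ p1 (ltW e2) e3); rewrite taylor_poly.
case: p {MP} p1 => [r||] //=; rewrite ?lee_fin => r1 n.
  rewrite big1 ?powR_ge0 // => k _; rewrite coef0 modulus0 powR0 ?mul0r //.
  by rewrite gt_eqF; lra.
by rewrite coef0 modulus0 mul0r ltW.
Qed.

Lemma norm_closure_sub p alpha M M' : M `<=` M' ->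
  norm_closure p alpha M `<=` norm_closure p alpha M'.
Proof.
move=> MM g [gl H]; split; first exact: gl.
by move=> e /H[h Mh hh]; exists h; [exact: MM | exact: hh].
Qed.

Lemma norm_closure_idem p alpha M : (1 <= p)%E -> M `<=` lspace p alpha ->
  norm_closure p alpha (norm_closure p alpha M) `<=` norm_closure p alpha M.
Proof.
move=> p1 Ml g [gl H]; split; first exact: gl.
(* The quasi-triangle inequality with factor 4 turns two errors [e / 16] into [e / 2]. *)
move=> e e0; have e1 : 0 < e / 16 by rewrite divr_gt0.
have [h [hl Hh] hgh] := H _ e1; have [k Mk hhk] := Hh _ e1; exists k; first exact: Mk.
have ga := gl.1; have ha := hl.1; have ka := (Ml _ Mk).1.
have b1 := (lnorm_leP alpha _ p1 (ltW e1)).1 (ltW hgh).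
have b2 := (lnorm_leP alpha _ p1 (ltW e1)).1 (ltW hhk).
have b3 := bounded_by_add p1 e1 e1 b1 b2.
have e2 : 0 <= 4 * (e / 16 + e / 16) by lra.
have e3 : 4 * (e / 16 + e / 16) < e by lra.
apply: (@lnorm_lt _ p alpha _ _ _ p1 e2 e3).
rewrite (_ : taylor (g \- k) = fun n => taylor (g \- h) n + taylor (h \- k) n); first exact: b3.
by apply/funext => n; rewrite !taylor_sub // addrA subrK.
Qed.

Lemma norm_closure_invariant p alpha M : (1 <= p)%E -> invariant_subspace p alpha M ->
  invariant_subspace p alpha (norm_closure p alpha M).
Proof.
move=> p1 [Ml M0 Mlin Mshift]; split; first by move=> g [].
- move: M0; rewrite (_ : (fun=> 0) = poly_fun (0 : {poly R[i]})); last first.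
    by apply/funext => z; rewrite /poly_fun horner0.
  exact: poly_in_norm_closure.
- move=> c g h [gl Hg] [hl Hh]; split; first exact: lspace_linear.
  (* Dividing by [modulus c + 1] avoids a case distinction in the choice of [g'] when [c = 0]. *)
  move=> e e0; set c1 := modulus c + 1.
  have c10 : 0 < c1 by rewrite ltr_wpDl ?modulus_ge0.
  have e1 : 0 < e / 16 / c1 by rewrite !divr_gt0.
  have e2 : 0 < e / 16 by rewrite divr_gt0.
  have [g' Mg' hg'] := Hg _ e1; have [h' Mh' hh'] := Hh _ e2.
  exists (fun z => c * g' z + h' z); first exact: Mlin.
  have ga := gl.1; have ha := hl.1; have ga' := (Ml _ Mg').1; have ha' := (Ml _ Mh').1.
  have b1 := (lnorm_leP alpha _ p1 (ltW e1)).1 (ltW hg').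
  have b2 := (lnorm_leP alpha _ p1 (ltW e2)).1 (ltW hh').
  have b1' : bounded_by p alpha (e / 16) (fun k => c * taylor (g \- g') k).
    have [c0|c0] := eqVneq c 0.
      have zb := bounded_by_scale 0 p1 e1 b1; rewrite modulus0 mul0r in zb.
      move: zb; rewrite c0; case: (p) p1 => [r||] //= r1 zb n; apply: (le_trans (zb n)).
        rewrite lee_fin in r1; rewrite powR0 ?powR_ge0 // gt_eqF; lra.
      exact: ltW.
    have ce : 0 < modulus c * (e / 16 / c1).
      by rewrite mulr_gt0 // lt_def modulus_eq0 c0 modulus_ge0.
    apply: (bounded_by_le p1 ce _ (bounded_by_scale c p1 e1 b1)).
    rewrite mulrA ler_pdivrMr // mulrC ler_wpM2l ?(ltW e2) // /c1; lra.
  have e3 : 0 <= 4 * (e / 16 + e / 16) by lra.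
  have e4 : 4 * (e / 16 + e / 16) < e by lra.
  apply: (@lnorm_lt _ p alpha _ _ _ p1 e3 e4).
  rewrite (_ : taylor _ = fun n => c * taylor (g \- g') n + taylor (h \- h') n).
    exact: bounded_by_add.
  apply/funext => n; rewrite taylor_sub; [|exact: analytic_linear..].
  rewrite !taylor_linear // !taylor_sub //.
  by rewrite mulrBr opprD addrACA.
- move=> g [gl Hg]; split; first exact: lspace_shift.
  move=> e e0; set C : R := 2 `^ `|alpha|; have C0 : 0 < C by rewrite powR_gt0.
  have e1 : 0 < e / 2 / C by rewrite !divr_gt0.
  have [h Mh hh] := Hg _ e1; exists (shift h); first exact: Mshift.
  have ga := gl.1; have ha := (Ml _ Mh).1.
  have b1 := (lnorm_leP alpha _ p1 (ltW e1)).1 (ltW hh).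
  have := bounded_by_shift p1 e1 b1; rewrite -/C mulrC divfK ?gt_eqF // => b2.
  have e2 : 0 <= e / 2 by lra.
  have e3 : e / 2 < e by lra.
  apply: (@lnorm_lt _ p alpha _ _ _ p1 e2 e3).
  rewrite (_ : shift g \- shift h = shift (g \- h)).
    by rewrite (taylor_shift (analytic_sub ga ha)); exact: b2.
  by apply/funext => z; rewrite /shift /= mulrBr.
Qed.

Lemma generated_sub_lspace p alpha cl f : (1 <= p)%E ->
  (forall M, cl M `<=` lspace p alpha) ->
  generated p alpha cl (poly_fun f) `<=` lspace p alpha.
Proof.
move=> p1 Hcl; apply: generated_invariant_sub; last exact: lspace_poly.
  exact: lspace_invariant.
exact: Hcl.
Qed.

Lemma cyclic_of_residuals r alpha f : 1 <= r ->
  (forall e, 0 < e -> exists Q, (residual_norm r%:E alpha f Q < e%:E)%E) ->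
  cyclic r%:E alpha (poly_fun f).
Proof.
move=> r1 res; have p1 : (1 <= r%:E)%E by rewrite lee_fin.
apply/seteqP; split; first by apply: generated_sub_lspace p1 _ => M g [].
move=> g gl M [[Mi Mc] Mf]; apply: (Mc); apply: polys_dense r1 _ gl.
exact: (polys_of_residuals p1 Mi Mc (Mf _ erefl) res).
Qed.

Lemma weak_star_cyclic_of_residuals alpha f :
  (forall e, 0 < e -> exists Q, (residual_norm +oo%E alpha f Q < e%:E)%E) ->
  weak_star_cyclic alpha (poly_fun f).
Proof.
move=> res; have p1 : (1 <= +oo :> \bar R)%E by rewrite leey.
apply/seteqP; split; first by apply: generated_sub_lspace p1 _ => M g [].
move=> g gl M [[Mi Mc] Mf]; apply: (Mc); apply: polys_weak_star_dense gl => P.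
have Mf' : M (poly_fun f) by exact: Mf.
rewrite -[P]mulr1; apply: (invariant_mul_poly _ Mi); apply: (Mc).
apply: norm_sub_weak_star; first exact: lspace_poly.
move=> e /res[Q hQ]; exists (Q * f); last exact: hQ.
exact: (invariant_mul_poly _ Mi).
Qed.

Lemma polys_invariant p alpha : (1 <= p)%E ->
  invariant_subspace p alpha (range (@poly_fun R)).
Proof.
move=> p1; split.
- by move=> _ [P _ <-]; exact: lspace_poly.
- by exists 0 => //; apply/funext => z; rewrite /poly_fun horner0.
- move=> c _ _ [P _ <-] [Q _ <-]; exists (c *: P + Q) => //.
  by apply/funext => z; rewrite /poly_fun hornerD hornerZ.
- move=> _ [P _ <-]; exists ('X * P) => //.
  by apply/funext => z; rewrite /poly_fun /shift hornerM hornerX.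
Qed.

(** The norm closure of the polynomials is itself a closed invariant subspace that contains [f],
    hence contains the generated one. Conversely every competitor contains all polynomials, and so
    their closure. *)
Lemma norm_cyclic_infty_of_residuals alpha f :
  (forall e, 0 < e -> exists Q, (residual_norm +oo%E alpha f Q < e%:E)%E) ->
  norm_cyclic_infty alpha (poly_fun f).
Proof.
move=> res; have p1 : (1 <= +oo :> \bar R)%E by rewrite leey.
have polI := polys_invariant alpha p1.
apply/seteqP; split.
  apply: generated_invariant_sub; first exact: norm_closure_invariant.
    by apply: norm_closure_idem => //; case: polI.
  by apply: poly_in_norm_closure => //; exists f.
move=> g gl M [[Mi Mc] Mf]; apply: (Mc); move: g gl; apply: norm_closure_sub => _ [P _ <-].
exact: (polys_of_residuals p1 Mi Mc (Mf _ erefl) res).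
Qed.

(** The kernel of evaluation at [z0]. As [z0] will lie on the unit circle, where [g] has no value,
    the condition is that the Taylor series at [z0] converges to 0. *)
Definition vanishing p alpha (z0 : R[i]) : set (disc_fun R) :=
  [set g | lspace p alpha g /\ is_pairing g (fun k => z0 ^+ k) 0].

Lemma vanishing_invariant p alpha z0 : (1 <= p)%E ->
  invariant_subspace p alpha (vanishing p alpha z0).
Proof.
move=> p1; split.
- by move=> g [].
- rewrite (_ : (fun=> 0) = poly_fun (0 : {poly R[i]})); last first.
    by apply/funext => z; rewrite /poly_fun horner0.
  split; first exact: lspace_poly.
  rewrite /is_pairing taylor_poly -[X in _ --> X](horner0 z0).
  exact: (@cvg_series_poly R 0 z0).
- move=> c g h [gl Hg] [hl Hh]; split; first exact: lspace_linear.
  have := @cvg_linear R _ _ _ _ c Hg Hh; rewrite mulr0 addr0.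
  rewrite (_ : (fun n => _) = series (fun k => taylor (fun z => c * g z + h z) k * z0 ^+ k)) //.
  apply/funext => n; rewrite /series /= mulr_sumr -big_split /=.
  apply: eq_bigr => k _; by rewrite (taylor_linear c k gl.1 hl.1) mulrDl mulrA.
- move=> g [gl Hg]; split; first exact: lspace_shift.
  by rewrite /is_pairing (taylor_shift gl.1) -(mulr0 z0); exact: cvg_series_shift_seq.
Qed.

Lemma not_generated p alpha cl f z0 : (1 <= p)%E -> root f z0 ->
  cl (vanishing p alpha z0) `<=` vanishing p alpha z0 ->
  ~ generated p alpha cl (poly_fun f) (poly_fun 1).
Proof.
move=> p1 fz0 Hcl H.
have [|_] := @generated_invariant_sub R p alpha cl f (vanishing p alpha z0)
  (vanishing_invariant alpha z0 p1) Hcl _ _ H.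
  split; first exact: lspace_poly.
  by have := @cvg_series_poly R f z0; rewrite (rootP fz0) /is_pairing taylor_poly.
rewrite /is_pairing taylor_poly => h0.
have h1 := @cvg_series_poly R 1 z0.
have /cvg_modulusP/(_ 1 ltr01)[N hN] := h0.
(* At least one term is needed for the partial sum of the constant 1 to equal 1. *)
have := hN (maxn N 1) (leq_maxl _ _).
rewrite (@series_poly R 1 z0 (maxn N 1)) ?size_poly1 ?leq_maxr //.
by rewrite hornerC subr0 modulus1 ltxx.
Qed.

(** The bound [C * e] holds for all partial sums at once, so those of [g] and of a nearby [h] differ
    by at most [e / 2] at every rank, and convergence to 0 passes from [h] to [g]. *)
Lemma vanishing_norm_closed p alpha z0 (C : R) : (1 <= p)%E -> 0 < C -> modulus z0 = 1 ->
  (forall e N a, 0 < e -> bounded_by p alpha e a ->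
     \sum_(0 <= k < N) modulus (a k) <= C * e) ->
  norm_closure p alpha (vanishing p alpha z0) `<=` vanishing p alpha z0.
Proof.
move=> p1 C0 z1 HC g [gl Hg]; split; first exact: gl.
apply/cvg_modulusP => e e0; have e1 : 0 < e / 2 / C by rewrite !divr_gt0.
have [h [hl Hh] gh] := Hg _ e1.
have b1 := (lnorm_leP alpha _ p1 (ltW e1)).1 (ltW gh).
have e2 : 0 < e / 2 by lra.
have /cvg_modulusP/(_ _ e2)[N hN] := Hh.
exists N => n Nn; have := hN n Nn; rewrite [X in modulus X < _ -> _]subr0 => hn.
rewrite [X in modulus X]subr0.
have -> : series (fun k => taylor g k * z0 ^+ k) n =
    series (fun k => taylor h k * z0 ^+ k) n +
    \sum_(0 <= k < n) taylor (g \- h) k * z0 ^+ k.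
  rewrite /series /= -big_split /=; apply: eq_bigr => k _.
  by rewrite (taylor_sub k gl.1 hl.1) -mulrDl addrC subrK.
apply: (le_lt_trans (modulusD _ _)).
have : modulus (\sum_(0 <= k < n) taylor (g \- h) k * z0 ^+ k) <= e / 2.
  apply: (le_trans (modulus_sum _ _ _)).
  under eq_bigr do rewrite modulusM modulusX z1 expr1n mulr1.
  by apply: (le_trans (HC _ n _ e1 b1)); rewrite mulrC divfK // gt_eqF.
by move=> hT; rewrite [e]splitr; exact: ltr_leD hn hT.
Qed.

Lemma vanishing_weak_star_closed alpha z0 : 1 < alpha -> modulus z0 = 1 ->
  weak_star_closure alpha (vanishing +oo%E alpha z0) `<=` vanishing +oo%E alpha z0.
Proof.
move=> a1 z1 g [gl Hg]; split; first exact: gl.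
apply/cvg_modulusP => e e0; have e2 : 0 < e / 2 by lra.
have [h [hl Hh] /(_ ord0) [l Hl le]] := Hg 1%N (fun=> fun k => z0 ^+ k) _ e2
  (fun=> predual_unimodular a1 z1).
(* The strict inequality [modulus l < e / 2] leaves room for the error of the partial sums of the
   pairing. *)
have e3 : 0 < e / 2 - modulus l by lra.
have /cvg_modulusP/(_ _ e3)[N1 hN1] := Hl.
have /cvg_modulusP/(_ _ e2)[N2 hN2] := Hh.
exists (maxn N1 N2) => n; rewrite geq_max => /andP[/hN1 n1 /hN2 n2].
rewrite [X in modulus X < _]subr0 in n2.
rewrite [X in modulus X]subr0.
have -> : series (fun k => taylor g k * z0 ^+ k) n =
    series (fun k => taylor h k * z0 ^+ k) n +
    (series (fun k => taylor (g \- h)%R k * z0 ^+ k) n - l + l).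
  rewrite subrK /series /= -big_split /=; apply: eq_bigr => k _.
  by rewrite (taylor_sub k gl.1 hl.1) -mulrDl addrC subrK.
apply: (le_lt_trans (modulusD _ _)).
apply: (le_lt_trans (lerD (lexx _) (modulusD _ _))).
have h12 := ltrD n2 n1.
rewrite addrA -ltrBrDr; apply: (lt_le_trans h12); lra.
Qed.

End Closures.

(** * Two families of approximants *)

Section Approximants.
Variable R : realType.
Variables (f : {poly R[i]}) (d : nat).
Hypothesis (deg_f : size f = d.+1) (d_gt0 : (0 < d)%N).
Hypothesis (Zf : forall z, root f z -> modulus z = 1).
Implicit Types (P Q : {poly R[i]}) (n k N : nat).

(** The degree [n + d] is shared by [d] factors, so [rho] has degree at most [N], the quotient of
    [n + d] by [d], and the block [[M, 2M)] is the longest of its kind that fits. Surviving indices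
    satisfy [N + 1 <= 3 * M <= 3 * k], which gives [3 * d]; the other factor 2 of the constant
    bounds [k / M] on the block. *)
Lemma flat_approximant : exists2 K : R, 0 < K & forall n, exists Q,
  [/\ (size Q <= n.+1)%N,
      forall k, modulus (1 - Q * f)`_k <= K / (n + d).+1%:R &
      forall k, (1 - Q * f)`_k != 0 -> (k <= n + d)%N /\ (n + d < 3 * d * k.+1)%N].
Proof.
exists (d%:R * 2 ^+ d * 2 * (3 * d)%:R).
  by rewrite !mulr_gt0 ?exprn_gt0 ?ltr0n ?muln_gt0.
move=> n; pose N := ((n + d) %/ d)%N; pose M := (N.+1 %/ 2)%N.
have dN : (d * N <= n + d)%N by rewrite mulnC leq_divM.
have N1 : (0 < N)%N by rewrite divn_gt0 // leq_addl.
have Nd : (n + d < N.+1 * d)%N by rewrite ltn_ceil.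
have M0 : (0 < M)%N by rewrite /M; lia.
have MN : ((2 * M).-1 <= N)%N by rewrite /M; lia.
have NM : (N <= 2 * M)%N by rewrite /M; lia.
have M0' : 0 < (M%:R : R) by rewrite ltr0n.
pose rho : {poly R} := \poly_(k < 2 * M) (if (M <= k)%N then M%:R^-1 else 0).
have rhoE k : rho`_k = if (M <= k < 2 * M)%N then M%:R^-1 else 0.
  by rewrite coef_poly; case: ltnP; rewrite ?andbF ?andbT.
have rho0 k : 0 <= rho`_k by rewrite rhoE; case: ifP => // _; rewrite invr_ge0 ler0n.
have rho1 : rho.[1] = 1.
  rewrite horner_poly; under eq_bigr do rewrite expr1n mulr1.
  rewrite -(big_mkord xpredT (fun k => if (M <= k)%N then M%:R^-1 else 0)).
  rewrite (@big_cat_nat _ _ _ M) //=; last by lia.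
  rewrite big_nat big1 ?add0r; last by move=> k /andP[_]; rewrite ltnNge => /negbTE ->.
  rewrite big_nat (eq_bigr (fun=> M%:R^-1)); last by move=> k /andP[->].
  rewrite -big_nat sumr_const_nat mul2n -addnn addnK -[RHS](mulVf (lt0r_neq0 M0')).
  by rewrite mulr_natr.
have rhob k : k%:R * rho`_k <= 2.
  rewrite rhoE; case: ifP => [/andP[_ kM]|]; last by rewrite mulr0.
  by rewrite ler_pdivrMr // -natrM ler_nat ltnW.
have rho00 : rho`_0 = 0 by rewrite rhoE leqNgt M0.
have srho : (d * (size rho).-1 <= n + d)%N.
  apply: leq_trans dN; rewrite leq_mul2l; apply/orP; right; apply: leq_trans MN.
  by have : (size rho <= 2 * M)%N := size_poly _ _; move: (size rho) => m; lia.
have [Q [sQ sP mP low]] := approximant_exists deg_f Zf rho0 rho1 rhob rho00 srho.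
exists Q.
have supp k : (1 - Q * f)`_k != 0 -> (k <= n + d)%N /\ (n + d < 3 * d * k.+1)%N.
  move=> Pk; split.
    rewrite -ltnS; apply: leq_trans sP; rewrite ltnNge; apply: contra Pk => le.
    by rewrite nth_default.
  have Mk : (M <= k)%N.
    rewrite leqNgt; apply: contra Pk => kM; rewrite (low M) // => j jM.
    by rewrite rhoE leqNgt jM.
  apply: (leq_trans Nd); rewrite mulnC (mulnC 3%N) -mulnA leq_mul2l; lia.
split=> // k; have [->|Pk] := eqVneq (1 - Q * f)`_k 0.
  by rewrite modulus0 !(divr_ge0, mulr_ge0) ?exprn_ge0 ?ler0n.
have [_ kn] := supp k Pk; apply: (le_trans (mP k)).
rewrite -[leRHS]mulrA ler_wpM2l ?mulr_ge0 ?exprn_ge0 ?ler0n //.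
rewrite ler_pdivlMr ?ltr0n // mulrC ler_pdivrMr ?ltr0n // -natrM ler_nat.
exact: kn.
Qed.

(** [n + d + 2 <= (N + 1) * (d + 1) <= (N + 1)^(d + 2)], as [N + 1 >= 2]. Thus rounding [n + d] down
    to a multiple of [d] costs the logarithm only a constant factor. *)
Lemma ln_mul_le n N : (0 < N)%N -> (n + d < N.+1 * d)%N ->
  ln ((n + d).+2%:R : R) <= d.+2%:R * ln (N.+1%:R : R).
Proof.
move=> N0 Nd; rewrite mulr_natl -lnXn ?ltr0n // ler_ln ?posrE ?exprn_gt0 ?ltr0n //.
rewrite -natrX ler_nat.
have h : (d.+1 <= N.+1 ^ d.+1)%N.
  by apply: (leq_trans (ltnW (ltn_expl d.+1 (ltnSn 1)))); rewrite leq_exp2r // ltnS.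
apply: (@leq_trans (N.+1 * d.+1)%N); first by rewrite mulnS; lia.
by rewrite expnS leq_mul2l h orbT.
Qed.

Lemma log_approximant : exists2 K : R, 0 < K & forall n, exists Q,
  [/\ (size Q <= n.+1)%N,
      forall k, modulus (1 - Q * f)`_k <= K / ln (n + d).+2%:R / k.+1%:R &
      forall k, (1 - Q * f)`_k != 0 -> (k <= n + d)%N].
Proof.
exists (d%:R * 2 ^+ d * d.+2%:R).
  by rewrite !mulr_gt0 ?exprn_gt0 ?ltr0n.
move=> n; pose N := ((n + d) %/ d)%N.
have dN : (d * N <= n + d)%N by rewrite mulnC leq_divM.
have N1 : (0 < N)%N by rewrite divn_gt0 // leq_addl.
have Nd : (n + d < N.+1 * d)%N by rewrite ltn_ceil.
pose H : R := \sum_(0 <= k < N) k.+1%:R^-1.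
have LH : ln (N.+1%:R : R) <= H := @ln_le_harmonic R N.
have LN0 : 0 < ln (N.+1%:R : R) by rewrite ln_gt0 // (ltr_nat R 1).
have H0 : 0 < H by apply: lt_le_trans LH.
(* Dividing by the harmonic sum [H] gives [rho(1) = 1] and makes [k * c k] equal to [H^-1] for every
   [k] from 1 to [N]. *)
pose c k : R := if k is j.+1 then (j.+1%:R * H)^-1 else 0.
pose rho : {poly R} := \poly_(k < N.+1) c k.
have c0 k : 0 <= c k by case: k => //= k; rewrite invr_ge0 mulr_ge0 ?ler0n ?ltW.
have rho0 k : 0 <= rho`_k by rewrite coef_poly; case: ifP.
have rho1 : rho.[1] = 1.
  rewrite horner_poly; under eq_bigr do rewrite expr1n mulr1.
  rewrite -(big_mkord xpredT c) big_nat_recl // add0r.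
  under eq_bigr do rewrite /c invfM.
  by rewrite -mulr_suml -/H mulfV ?gt_eqF.
have rhob k : k%:R * rho`_k <= H^-1.
  rewrite coef_poly; case: ifP => _; last by rewrite mulr0 invr_ge0 ltW.
  case: k => [|k]; first by rewrite mul0r invr_ge0 ltW.
  by rewrite /c invfM mulrA mulfV ?pnatr_eq0 // mul1r.
have rho00 : rho`_0 = 0 by rewrite coef_poly.
have srho : (d * (size rho).-1 <= n + d)%N.
  apply: leq_trans dN; rewrite leq_mul2l; apply/orP; right.
  by have : (size rho <= N.+1)%N := size_poly _ _; move: (size rho) => m; lia.
have [Q [sQ sP mP _]] := approximant_exists deg_f Zf rho0 rho1 rhob rho00 srho.
exists Q; split=> // k.
  have L0 : 0 < ln ((n + d).+2%:R : R) by rewrite ln_gt0 // (ltr_nat R 1).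
  apply: (le_trans (mP k)); rewrite ler_pM2r ?invr_gt0 ?ltr0n //.
  rewrite -!mulrA ler_wpM2l ?ler0n // ler_wpM2l ?exprn_ge0 //.
  rewrite ler_pdivlMr // mulrC ler_pdivrMr //.
  by apply: (le_trans (ln_mul_le N1 Nd)); rewrite ler_wpM2l ?ler0n.
move=> Pk; rewrite -ltnS; apply: leq_trans sP; rewrite ltnNge; apply: contra Pk => le.
by rewrite nth_default.
Qed.

End Approximants.

(** * Rates *)

Section Rates.
Variable R : realType.
Implicit Types (x : nat -> R) (p alpha e t : R) (N : nat).

(** The rate of the theorem for [N = n + d + 1], the number of coefficients of a residual. *)
Definition rate p alpha N : R :=
  if alpha < p - 1 then N%:R `^ (alpha + 1 - p)
  else if alpha == p - 1 then ln N.+1%:R `^ (1 - p) else 1.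

Definition sup_rate alpha N : R :=
  if alpha < 1 then N%:R `^ (alpha - 1)
  else if alpha == 1 then (ln N.+1%:R)^-1 else 1.

Lemma rate_ge0 p alpha N : 0 <= rate p alpha N.
Proof. by rewrite /rate; case: ifP => _; [|case: ifP => _]; rewrite ?powR_ge0. Qed.

Lemma sup_rate_ge0 alpha N : 0 <= sup_rate alpha N.
Proof.
rewrite /sup_rate; case: ifP => _; [|case: ifP => _]; rewrite ?powR_ge0 //.
by rewrite invr_ge0 ln_ge0 // (ler_nat R 1).
Qed.

Lemma rate_lower p alpha : 1 <= p ->
  exists2 c : R, 0 < c & forall N x, (forall k, 0 <= x k) -> (0 < N)%N ->
    1 <= \sum_(0 <= k < N) x k ->
    c * rate p alpha N <= \sum_(0 <= k < N) x k `^ p * k.+1%:R `^ alpha.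
Proof.
move=> p1; rewrite /rate; have [ap|ap|->] := ltgtP alpha (p - 1).
- exact: weighted_sum_ge_lt.
- have [|C C0 HC] := @evaluation_bounded R p alpha p1; first by left.
  (* A weighted sum below [(2 * C)^(- p)] would force the plain sum below one half. *)
  have e0 : 0 < (2 * C)^-1 by rewrite invr_gt0 mulr_gt0.
  exists ((2 * C)^-1 `^ p); first by rewrite powR_gt0.
  move=> N x x0 _ x1; rewrite mulr1 leNgt; apply/negP => /ltW h.
  have := le_trans x1 (HC _ _ _ x0 e0 h).
  have -> : C * (2 * C)^-1 = 2^-1 by field; rewrite gt_eqF.
  lra.
- exact: weighted_sum_ge_eq.
Qed.

Lemma sup_rate_lower alpha :
  exists2 c : R, 0 < c & forall N x, (forall k, 0 <= x k) -> (0 < N)%N ->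
    1 <= \sum_(0 <= k < N) x k ->
    forall E, 0 <= E -> (forall k, (k < N)%N -> x k * k.+1%:R `^ alpha <= E) ->
    c * sup_rate alpha N <= E.
Proof.
(* From [1 <= E * S], with [S] the sum of the inverse weights, it is enough that the rate is at most
   a constant over [S]. *)
suff [C C0 HC] : exists2 C : R, 0 < C & forall N, (0 < N)%N ->
    \sum_(0 <= k < N) k.+1%:R `^ (- alpha) * sup_rate alpha N <= C.
  exists C^-1; first by rewrite invr_gt0.
  move=> N x x0 N0 x1 E E0 hE; rewrite mulrC ler_pdivrMr //.
  have h := le_trans x1 (sum_le_sup E0 hE).
  apply: le_trans (ler_wpM2l E0 (HC N N0)).
  by rewrite -mulr_suml mulrA -[leLHS]mul1r ler_wpM2r ?sup_rate_ge0.
rewrite /sup_rate; have [a1|a1|->] := ltgtP alpha 1.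
- have [C C0 HC] := sum_powRN_le a1; exists C => // -[//|N] _; rewrite -mulr_suml.
  have := ler_wpM2r (powR_ge0 N.+1%:R (alpha - 1)) (HC N.+1).
  rewrite -mulrA -powR_succD.
  have -> : 1 - alpha + (alpha - 1) = 0 by ring.
  by rewrite powRr0 mulr1.
- have [C C0 HC] := sum_powRN_bounded a1; exists C => // N _.
  by under eq_bigr do rewrite mulr1.
- exists 2 => // -[//|N] _; rewrite -mulr_suml.
  have L0 : 0 < ln (N.+2%:R : R) by rewrite ln_gt0 // (ltr_nat R 1).
  rewrite ler_pdivrMr //; apply: le_trans (@harmonic_le_ln R N.+1).
  by apply: ler_sum => k _; rewrite powR_inv1.
Qed.

(** [k + 1] lies between [N / C] and [N]. The summand 1 serves [alpha >= 0], and the summand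
    [C^(- alpha)] serves [alpha < 0]. *)
Lemma powR_range_le (C alpha : R) k N : 1 <= C -> (k < N)%N -> N%:R <= C * k.+1%:R ->
  k.+1%:R `^ alpha <= (1 + C `^ (- alpha)) * N%:R `^ alpha.
Proof.
case: N => // N C1 kN NC; rewrite mulrDl mul1r.
have [a0|a0] := lerP 0 alpha.
  apply: (@le_trans _ _ (N.+1%:R `^ alpha)).
    by apply: ge0_ler_powR; rewrite ?nnegrE ?ler0n // ler_nat.
  by rewrite lerDl mulr_ge0 ?powR_ge0.
apply: (@le_trans _ _ (C `^ (- alpha) * N.+1%:R `^ alpha)); last by rewrite lerDr powR_ge0.
have C0 : 0 < C by lra.
rewrite -[alpha]opprK (powRN k.+1%:R) (powRN N.+1%:R) opprK.
rewrite ler_pdivlMr ?powR_succ_gt0 // mulrC ler_pdivrMr ?powR_succ_gt0 //.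
rewrite -powRM ?ler0n ?(ltW C0) //.
by apply: ge0_ler_powR; rewrite ?nnegrE ?mulr_ge0 ?ler0n ?(ltW C0) //; lra.
Qed.

Lemma sum_supported_le (u v : nat -> R) N : (forall k, 0 <= v k) ->
  (forall k, u k <= if (k < N)%N then v k else 0) ->
  forall N', \sum_(0 <= k < N') u k <= \sum_(0 <= k < N) v k.
Proof.
move=> v0 uv N'; have [le|lt] := leqP N' N.
  rewrite [leRHS](@big_cat_nat _ _ _ N') //= -[leLHS]addr0; apply: lerD.
    apply: ler_sum_nat => k /andP[_ kN']; have := uv k.
    by rewrite (leq_trans kN').
  by apply: sumr_ge0.
rewrite (@big_cat_nat _ _ _ N) ?(ltnW lt) //= -[leRHS]addr0; apply: lerD.
  by apply: ler_sum_nat => k /andP[_ kN]; have := uv k; rewrite kN.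
rewrite big_nat; apply: sumr_le0 => k /andP[Nk _].
by have := uv k; rewrite ltnNge Nk.
Qed.

(** At most [N] terms are nonzero, each of order [N^(alpha - p)]. *)
Lemma flat_sum_le p alpha (C K : R) N x : 1 <= p -> 1 <= C -> 0 <= K -> (0 < N)%N ->
  (forall k, 0 <= x k <= K / N%:R) ->
  (forall k, x k != 0 -> (k < N)%N /\ N%:R <= C * k.+1%:R) ->
  forall N', \sum_(0 <= k < N') x k `^ p * k.+1%:R `^ alpha <=
    K `^ p * (1 + C `^ (- alpha)) * N%:R `^ (alpha + 1 - p).
Proof.
case: N => // N p1 C1 K0 _ xK xs.
set B := _ * _; pose T : R := K `^ p * N.+1%:R `^ (- p) * ((1 + C `^ (- alpha)) * N.+1%:R `^ alpha).
have T0 : 0 <= T by rewrite !mulr_ge0 ?addr_ge0 ?powR_ge0.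
have term k : x k `^ p * k.+1%:R `^ alpha <= if (k < N.+1)%N then T else 0.
  have [x0|xk] := eqVneq (x k) 0.
    by rewrite x0 powR0 ?mul0r; [case: ifP | rewrite gt_eqF; lra].
  have [kN NC] := xs k xk; rewrite kN; apply: ler_pM; rewrite ?powR_ge0 //.
    have /andP[xk0 xkK] := xK k.
    rewrite powRN -powR_inv1 ?powR_ge0 // -powRrM mulrN1 -[- p]mulN1r powRrM.
    rewrite powR_inv1 ?ler0n // -powRM ?invr_ge0 ?ler0n //.
    by apply: ge0_ler_powR; rewrite ?nnegrE ?divr_ge0 ?ler0n //; lra.
  exact: powR_range_le.
have BT : B = \sum_(0 <= k < N.+1) T.
  rewrite sumr_const_nat subn0 -mulr_natr /B /T.
  have -> : alpha + 1 - p = - p + (alpha + 1) by ring.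
  by rewrite !powR_succD powRr1 ?ler0n //; ring.
by rewrite BT; exact: sum_supported_le.
Qed.

Lemma flat_sup_le alpha (C K : R) N x : 1 <= C -> 0 <= K -> (0 < N)%N ->
  (forall k, 0 <= x k <= K / N%:R) ->
  (forall k, x k != 0 -> (k < N)%N /\ N%:R <= C * k.+1%:R) ->
  forall k, x k * k.+1%:R `^ alpha <= K * (1 + C `^ (- alpha)) * N%:R `^ (alpha - 1).
Proof.
case: N => // N C1 K0 _ xK xs k.
have [->|xk] := eqVneq (x k) 0.
  by rewrite mul0r !mulr_ge0 ?addr_ge0 ?powR_ge0.
have [kN NC] := xs k xk; have /andP[xk0 xkK] := xK k.
apply: (le_trans (ler_pM _ _ xkK (powR_range_le alpha C1 kN NC))); rewrite ?powR_ge0 //.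
rewrite powR_succD powR_inv1 ?ler0n //; rewrite le_eqVlt; apply/orP; left; apply/eqP; ring.
Qed.

Lemma log_sum_le p (K : R) N x : 1 <= p -> 0 <= K -> (0 < N)%N ->
  (forall k, 0 <= x k <= K / ln N.+1%:R / k.+1%:R) ->
  (forall k, x k != 0 -> (k < N)%N) ->
  forall N', \sum_(0 <= k < N') x k `^ p * k.+1%:R `^ (p - 1) <=
    2 * K `^ p * ln N.+1%:R `^ (1 - p).
Proof.
move=> p1 K0 N0 xK xs N'.
have L0 : 0 < ln (N.+1%:R : R) by rewrite ln_gt0 // (ltr_nat R 1).
(* The powers of [k + 1] combine to [1 / (k + 1)], so the harmonic sum gives back one of the [p]
   logarithms. *)
pose T : R := K `^ p * ln N.+1%:R `^ (- p).
have T0 : 0 <= T by rewrite mulr_ge0 ?powR_ge0.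
have term k : x k `^ p * k.+1%:R `^ (p - 1) <= if (k < N)%N then T * k.+1%:R^-1 else 0.
  have [x0|xk] := eqVneq (x k) 0.
    rewrite x0 powR0 ?mul0r; last by rewrite gt_eqF; lra.
    by case: ifP => // _; rewrite mulr_ge0 ?invr_ge0.
  rewrite (xs k xk); have /andP[xk0 xkK] := xK k.
  apply: (@le_trans _ _ ((K / ln N.+1%:R / k.+1%:R) `^ p * k.+1%:R `^ (p - 1))).
    rewrite ler_wpM2r ?powR_ge0 //; apply: ge0_ler_powR; rewrite ?nnegrE //; first lra.
    by rewrite !divr_ge0 ?ler0n ?(ltW L0).
  rewrite !powRM ?divr_ge0 ?invr_ge0 ?ler0n ?(ltW L0) //.
  rewrite -!(powR_inv1 (ler0n _ _)) -(powR_inv1 (ltW L0)) -!powRrM !mulN1r -mulrA -powR_succD.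
  by rewrite addrA addNr add0r.
apply: (le_trans (sum_supported_le _ term N')).
  by move=> k; rewrite mulr_ge0 ?invr_ge0.
rewrite -mulr_sumr; apply: (le_trans (ler_wpM2l T0 (@harmonic_le_ln R N))).
have -> : ln N.+1%:R `^ (1 - p) = ln (N.+1%:R : R) * ln N.+1%:R `^ (- p).
  by rewrite powRD ?powRr1 ?(ltW L0) // (gt_eqF L0) implybT.
rewrite /T; rewrite le_eqVlt; apply/orP; left; apply/eqP; ring.
Qed.

Lemma powR_neg_small (g e : R) : g < 0 -> 0 < e ->
  exists X : R, forall t, X < t -> t `^ g < e.
Proof.
move=> g0 e0; exists (e `^ g^-1) => t et.
have X0 : 0 < e `^ g^-1 by rewrite powR_gt0.
have t0 : 0 < t by apply: lt_trans et.
have {1}-> : e = (e `^ g^-1) `^ g by rewrite -powRrM mulVf ?powRr1 ?(ltW e0) // lt_eqF.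
rewrite -[g]opprK ![_ `^ (- - g)]powRN ltf_pV2 ?posrE ?powR_gt0 //.
  by apply: gt0_ltr_powR; rewrite ?nnegrE ?opprK ?(ltW t0) ?(ltW X0) //; lra.
Qed.

Lemma exists_nat_gt (X : R) : exists n : nat, X < n%:R.
Proof.
exists (Num.truncn `|X|).+1; apply: le_lt_trans (ler_norm X) _.
exact: truncnS_gt.
Qed.

Lemma ln_unbounded (X : R) m : exists n, X < ln (n + m).+1%:R.
Proof.
have [n hn] := exists_nat_gt (expR X); exists n.
have n0 : 0 < (n%:R : R) by apply: lt_trans hn; rewrite expR_gt0.
rewrite -[X]expRK ltr_ln ?posrE ?expR_gt0 ?ltr0n //.
by apply: (lt_trans hn); rewrite ltr_nat ltnS leq_addr.
Qed.

(** For [p = 1] and [alpha = 0] the exponent [1 - p] of the logarithm is 0 and the rate stays 1,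
    hence the strict inequality for [p = 1]. *)
Lemma rate_small p alpha e m : alpha < p - 1 \/ alpha = p - 1 /\ 1 < p -> 0 < e ->
  exists n, rate p alpha (n + m) < e.
Proof.
rewrite /rate => H e0; have [ap|ap|ap] := ltgtP alpha (p - 1).
- have [|X HX] := @powR_neg_small (alpha + 1 - p) e _ e0; first lra.
  have [n hn] := exists_nat_gt X; exists n; apply: HX; apply: (lt_le_trans hn).
  by rewrite ler_nat leq_addr.
- by case: H; lra.
- have [|X HX] := @powR_neg_small (1 - p) e _ e0; first by case: H; lra.
  by have [n hn] := ln_unbounded X m; exists n; exact: HX.
Qed.

Lemma sup_rate_small alpha e m : alpha <= 1 -> 0 < e -> exists n, sup_rate alpha (n + m) < e.
Proof.
rewrite /sup_rate => H e0; have [ap|ap|ap] := ltgtP alpha 1.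
- have [|X HX] := @powR_neg_small (alpha - 1) e _ e0; first lra.
  have [n hn] := exists_nat_gt X; exists n; apply: HX; apply: (lt_le_trans hn).
  by rewrite ler_nat leq_addr.
- lra.
- have [n hn] := ln_unbounded e^-1 m; exists n.
  rewrite -[e]invrK ltf_pV2 ?posrE ?invr_gt0 //.
  by apply: lt_trans hn; rewrite invr_gt0.
Qed.

End Rates.

(** * Residuals *)

Section Residuals.
Variable R : realType.
Variables (f : {poly R[i]}) (d : nat) (z0 : R[i]).
Hypothesis (deg_f : size f = d.+1) (fz0 : root f z0).
Hypothesis (Zf : forall z, root f z -> modulus z = 1).
Implicit Types (Q : {poly R[i]}) (n k N : nat) (p alpha : R).

Let d_gt0 : (0 < d)%N.
Proof.
by rewrite -ltnS -deg_f (root_size_gt1 _ fz0) // -size_poly_gt0 deg_f.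
Qed.

Lemma residual_sum_ge1 n Q : (size Q <= n.+1)%N ->
  1 <= \sum_(0 <= k < (n + d).+1) modulus (1 - Q * f)`_k.
Proof.
move=> sQ; have sP : (size (1 - Q * f)%R <= (n + d).+1)%N.
  apply: (leq_trans (size_polyD _ _)); rewrite size_polyN size_poly1 geq_max /=.
  apply: (leq_trans (size_polyMleq _ _)); rewrite deg_f.
  by move: (size Q) sQ => m; lia.
have : (1 - Q * f).[z0] = 1 by rewrite !hornerE (rootP fz0) mulr0 subr0.
rewrite (horner_coef_wide _ sP) => H; rewrite -[leLHS](@modulus1 R) -H.
rewrite -(big_mkord xpredT (fun k => (1 - Q * f)`_k * z0 ^+ k)).
apply: (le_trans (modulus_sum _ _ _)); apply: ler_sum => k _.
by rewrite modulusM modulusX (Zf fz0) expr1n mulr1.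
Qed.

Lemma poweR_lnorm p alpha (g : disc_fun R) : 0 < p ->
  poweR (lnorm p%:E alpha g) p =
  (\sum_(0 <= k <oo) (modulus (taylor g k) `^ p * k.+1%:R `^ alpha)%:E)%E.
Proof.
move=> p0; rewrite /lnorm -poweRrM mulVf ?gt_eqF // poweRe1 //.
by apply: nneseries_ge0 => k _ _; rewrite lee_fin weight_ge0.
Qed.

Lemma residual_lower p alpha : 1 <= p ->
  exists2 c : R, 0 < c & forall n Q, (size Q <= n.+1)%N ->
    ((c * rate p alpha (n + d).+1)%:E <= poweR (residual_norm p%:E alpha f Q) p)%E.
Proof.
move=> p1; have [c c0 Hc] := rate_lower alpha p1; exists c => // n Q sQ.
have p0 : 0 < p by lra.
rewrite (poweR_lnorm _ _ p0) taylor_poly.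
have h := Hc _ _ (fun k => modulus_ge0 _) (ltn0Sn _) (residual_sum_ge1 sQ).
apply: (@le_trans _ _ (\sum_(0 <= k < (n + d).+1)
   modulus (1 - Q * f)`_k `^ p * k.+1%:R `^ alpha)%:E); first by rewrite lee_fin.
rewrite -sumEFin; apply: nneseries_lim_ge => k _ _.
by rewrite lee_fin mulr_ge0 ?powR_ge0.
Qed.

Lemma residual_upper p alpha : 1 <= p ->
  exists2 K : R, 0 < K & forall n, exists2 Q : {poly R[i]}, (size Q <= n.+1)%N &
    forall N, \sum_(0 <= k < N) modulus (1 - Q * f)`_k `^ p * k.+1%:R `^ alpha <=
      K * rate p alpha (n + d).+1.
Proof.
move=> p1; rewrite /rate; have [ap|ap|->] := ltgtP alpha (p - 1).
- have [K K0 HK] := flat_approximant deg_f d_gt0 Zf.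
  exists (K `^ p * (1 + (3 * d)%:R `^ (- alpha))).
    by rewrite mulr_gt0 ?powR_gt0 // ltr_pwDl ?powR_ge0.
  move=> n; have [Q [sQ QK Qs]] := HK n; exists Q => //.
  apply: flat_sum_le => //; first by rewrite (ler_nat R 1) muln_gt0.
  - exact: ltW.
  - by move=> k; rewrite modulus_ge0 QK.
  - move=> k; rewrite modulus_eq0 => /Qs[kn nk]; split=> //.
    by rewrite -natrM ler_nat.
- exists 1 => // n; exists 0; rewrite ?size_poly0 // => N.
  rewrite mul0r subr0 mulr1; case: N => [|N]; first by rewrite big_geq.
  rewrite big_nat_recl // coef1 [modulus _]modulus1 !powR1 mulr1.
  rewrite big1 ?addr0 // => k _.
  by rewrite coef1 [modulus _]modulus0 powR0 ?mul0r // gt_eqF //; lra.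
- have [K K0 HK] := log_approximant deg_f d_gt0 Zf.
  exists (2 * K `^ p); first by rewrite mulr_gt0 ?powR_gt0.
  move=> n; have [Q [sQ QK Qs]] := HK n; exists Q => //.
  apply: log_sum_le => //; first exact: ltW.
  - by move=> k; rewrite modulus_ge0 QK.
  - by move=> k; rewrite modulus_eq0 => /Qs.
Qed.

Lemma sup_residual_lower alpha :
  exists2 c : R, 0 < c & forall n Q, (size Q <= n.+1)%N ->
    ((c * sup_rate alpha (n + d).+1)%:E <= residual_norm +oo%E alpha f Q)%E.
Proof.
have [c c0 Hc] := @sup_rate_lower R alpha; exists c => // n Q sQ.
have p1 : (1 <= +oo :> \bar R)%E by rewrite leey.
have E0 := lnorm_ge0 alpha (poly_fun (1 - Q * f)) p1.
have Ef : residual_norm +oo%E alpha f Q \is a fin_num.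
  by rewrite ge0_fin_numE //; case: (lspace_poly alpha (1 - Q * f) p1).
rewrite -(fineK Ef) lee_fin.
apply: (Hc _ _ (fun k => modulus_ge0 _) (ltn0Sn _) (residual_sum_ge1 sQ)).
  exact: fine_ge0.
move=> k _; have := (lnorm_leP alpha (poly_fun (1 - Q * f)) p1 (fine_ge0 E0)).1.
by rewrite taylor_poly; apply; rewrite fineK.
Qed.

Lemma sup_residual_upper alpha :
  exists2 K : R, 0 < K & forall n, exists2 Q : {poly R[i]}, (size Q <= n.+1)%N &
    forall k, modulus (1 - Q * f)`_k * k.+1%:R `^ alpha <= K * sup_rate alpha (n + d).+1.
Proof.
rewrite /sup_rate; have [a1|a1|->] := ltgtP alpha 1.
- have [K K0 HK] := flat_approximant deg_f d_gt0 Zf.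
  exists (K * (1 + (3 * d)%:R `^ (- alpha))).
    by rewrite mulr_gt0 // ltr_pwDl ?powR_ge0.
  move=> n; have [Q [sQ QK Qs]] := HK n; exists Q => //.
  apply: flat_sup_le => //; first by rewrite (ler_nat R 1) muln_gt0.
  - exact: ltW.
  - by move=> k; rewrite modulus_ge0 QK.
  - move=> k; rewrite modulus_eq0 => /Qs[kn nk]; split=> //.
    by rewrite -natrM ler_nat.
- exists 1 => // n; exists 0; rewrite ?size_poly0 // => k.
  rewrite mul0r subr0 mulr1 coef1; case: k => [|k].
    by rewrite [modulus _]modulus1 powR1 mulr1.
  by rewrite [modulus _]modulus0 mul0r.
- have [K K0 HK] := log_approximant deg_f d_gt0 Zf.
  exists K => // n; have [Q [sQ QK Qs]] := HK n; exists Q => // k.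
  by rewrite powRr1 ?ler0n // -ler_pdivlMr ?ltr0n.
Qed.

Lemma residual_small p alpha : 1 <= p -> alpha < p - 1 \/ alpha = p - 1 /\ 1 < p ->
  forall e : R, 0 < e -> exists Q, (residual_norm p%:E alpha f Q < e%:E)%E.
Proof.
move=> p1 H e e0; have [K K0 HK] := residual_upper alpha p1.
have e2 : 0 < e / 2 by lra.
have e3 : e / 2 < e by lra.
have ep : 0 < (e / 2) `^ p / K by rewrite divr_gt0 ?powR_gt0.
have [n hn] := rate_small d.+1 H ep; rewrite addnS in hn.
have [Q sQ hQ] := HK n; exists Q.
have p1' : (1 <= p%:E)%E by rewrite lee_fin.
apply: (@lnorm_lt _ p%:E alpha _ _ _ p1' (ltW e2) e3); rewrite taylor_poly => N.
apply: (le_trans (hQ N)); rewrite mulrC -ler_pdivlMr //; exact: ltW.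
Qed.

Lemma sup_residual_small alpha : alpha <= 1 ->
  forall e : R, 0 < e -> exists Q, (residual_norm +oo%E alpha f Q < e%:E)%E.
Proof.
move=> a1 e e0; have [K K0 HK] := sup_residual_upper alpha.
have e2 : 0 < e / 2 by lra.
have e3 : e / 2 < e by lra.
have ep : 0 < e / 2 / K by rewrite divr_gt0.
have [n hn] := sup_rate_small d.+1 a1 ep; rewrite addnS in hn.
have [Q sQ hQ] := HK n; exists Q.
have p1 : (1 <= +oo :> \bar R)%E by rewrite leey.
apply: (@lnorm_lt _ +oo%E alpha _ _ _ p1 (ltW e2) e3); rewrite taylor_poly => k.
apply: (le_trans (hQ k)); rewrite mulrC -ler_pdivlMr //; exact: ltW.
Qed.

Lemma not_cyclic p alpha : 1 <= p -> p - 1 < alpha \/ p = 1 /\ 0 <= alpha ->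
  ~ cyclic p%:E alpha (poly_fun f).
Proof.
move=> p1 H cyc; have [C C0 HC] := evaluation_bounded p1 H.
have p1' : (1 <= p%:E)%E by rewrite lee_fin.
apply: (@not_generated _ p%:E alpha (norm_closure p%:E alpha) f z0 p1' fz0).
  apply: (vanishing_norm_closed p1' C0 (Zf fz0)) => e N a e0 ha.
  exact: HC (fun k => modulus_ge0 _) e0 (ha N).
by rewrite [generated _ _ _ _]cyc; exact: lspace_poly.
Qed.

Lemma not_weak_star_cyclic alpha : 1 < alpha -> ~ weak_star_cyclic alpha (poly_fun f).
Proof.
move=> a1 cyc; have p1 : (1 <= +oo :> \bar R)%E by rewrite leey.
apply: (@not_generated _ +oo%E alpha (weak_star_closure alpha) f z0 p1 fz0).
  exact: vanishing_weak_star_closed a1 (Zf fz0).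
by rewrite [generated _ _ _ _]cyc; exact: lspace_poly.
Qed.

Lemma not_norm_cyclic_infty alpha : 1 < alpha -> ~ norm_cyclic_infty alpha (poly_fun f).
Proof.
move=> a1 cyc; have p1 : (1 <= +oo :> \bar R)%E by rewrite leey.
have [C C0 HC] := sum_powRN_bounded a1.
apply: (@not_generated _ +oo%E alpha (norm_closure +oo%E alpha) f z0 p1 fz0).
  apply: (vanishing_norm_closed p1 C0 (Zf fz0)) => e N a e0 ha.
  apply: (le_trans (sum_le_sup (ltW e0) (fun k _ => ha k))).
  by rewrite mulrC ler_wpM2r ?(ltW e0).
by rewrite [generated _ _ _ _]cyc; apply: poly_in_norm_closure => //; exists 1.
Qed.

(** [phi] is the power [p] for finite exponents and the identity for the supremum norm. The lower
    bound is applied to the optimal polynomial itself, the upper one to a competitor in the infimum;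
    [c^-1 + K] dominates both constants. *)
Lemma comparable_optimal (p : \bar R) alpha (phi : \bar R -> \bar R) (r B : nat -> R) (c K : R) pn :
  (1 <= p)%E -> 0 < c -> 0 < K -> (forall n, 0 <= r n) -> B =1 r ->
  (forall x y, (0 <= x)%E -> (x <= y)%E -> (phi x <= phi y)%E) ->
  (forall n Q, (size Q <= n.+1)%N -> ((c * r n)%:E <= phi (residual_norm p alpha f Q))%E) ->
  (forall n, exists2 Q : {poly R[i]}, (size Q <= n.+1)%N &
     (phi (residual_norm p alpha f Q) <= (K * r n)%:E)%E) ->
  (forall n, optimal_approximant p alpha f n (pn n)) ->
  Defs.comparable (fun n => phi (residual_norm p alpha f (pn n))) B.
Proof.
move=> p1 c0 K0 r0 Br mono lo up opt; exists (c^-1 + K); first by rewrite addr_gt0 ?invr_gt0.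
move=> n; rewrite Br; have [spn ->] := opt n; split.
  have [sp <-] := opt n; apply: le_trans (lo n _ spn); rewrite lee_fin ler_wpM2r //.
  rewrite -[leRHS]invrK lef_pV2 ?posrE ?addr_gt0 ?invr_gt0 //.
  by rewrite lerDl ltW.
have [Q sQ hQ] := up n; apply: (@le_trans _ _ (K * r n)%:E); last first.
  by rewrite lee_fin ler_wpM2r // lerDr invr_ge0 ltW.
apply: le_trans hQ; apply: mono.
  by apply: le_ereal_inf_tmp => _ [P _ <-]; exact: lnorm_ge0.
by apply: ereal_inf_lbound; exists Q.
Qed.

End Residuals.

Theorem theorem1p5 (R : realType) (f : {poly R[i]}) (d : nat) (alpha : R)
    (deg_f : size f = d.+1)
    (Zf_nonempty : exists z : R[i], root f z)
    (Zf_circle : forall z : R[i], root f z -> `|z| = 1) :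
  [/\ (* (i) *)
      [/\ forall p : R, 1 < p ->
            cyclic p%:E alpha (poly_fun f) <-> alpha <= p - 1,
          cyclic 1%:E alpha (poly_fun f) <-> alpha < 0,
          weak_star_cyclic alpha (poly_fun f) <-> alpha <= 1
        & norm_cyclic_infty alpha (poly_fun f) <-> alpha <= 1],
      (* (ii) *)
      forall (p : R) (pn : nat -> {poly R[i]}), 1 <= p ->
        (forall n, optimal_approximant p%:E alpha f n (pn n)) ->
        comparable (fun n => poweR (residual_norm p%:E alpha f (pn n)) p)
          (fun n => if alpha < p - 1 then (n + d + 1)%:R `^ (alpha + 1 - p)
                    else if alpha == p - 1 then ln (n + d + 2)%:R `^ (1 - p)
                    else 1)
    & (* (iii) *)
      forall pn : nat -> {poly R[i]},
        (forall n, optimal_approximant +oo%E alpha f n (pn n)) ->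
        comparable (fun n => residual_norm +oo%E alpha f (pn n))
          (fun n => if alpha < 1 then (n + d + 1)%:R `^ (alpha - 1)
                    else if alpha == 1 then (ln (n + d + 2)%:R)^-1
                    else 1)].
Proof.
have [z0 fz0] := Zf_nonempty.
have Zf z : root f z -> modulus z = 1 by move=> /Zf_circle h; rewrite modulusE h.
split; first split.
- move=> p p1; split=> [cyc|ap].
    rewrite leNgt; apply/negP => ap.
    by apply: (not_cyclic fz0 Zf (ltW p1) _ cyc); left.
  apply: (cyclic_of_residuals (ltW p1)); apply: (residual_small deg_f fz0 Zf (ltW p1)).
  by move: ap; rewrite le_eqVlt => /predU1P[->|]; [right|left].
- split=> [cyc|a0].
    rewrite ltNge; apply/negP => a0.
    (* For [p = 1] evaluation is already bounded at the critical exponent [alpha = 0]. *)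
    by apply: (not_cyclic fz0 Zf (lexx 1) _ cyc); right.
  apply: (cyclic_of_residuals (lexx 1)); apply: (residual_small deg_f fz0 Zf (lexx 1)).
  by left; rewrite subrr.
- split=> [cyc|a1].
    by rewrite leNgt; apply/negP => a1; exact: (not_weak_star_cyclic fz0 Zf a1 cyc).
  apply: weak_star_cyclic_of_residuals; exact: (sup_residual_small deg_f fz0 Zf a1).
- split=> [cyc|a1].
    by rewrite leNgt; apply/negP => a1; exact: (not_norm_cyclic_infty fz0 Zf a1 cyc).
  apply: norm_cyclic_infty_of_residuals; exact: (sup_residual_small deg_f fz0 Zf a1).
- move=> p pn p1 opt.
  have [c c0 lo] := residual_lower deg_f fz0 Zf alpha p1.
  have [K K0 up] := residual_upper deg_f fz0 Zf alpha p1.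
  apply: (comparable_optimal (phi := fun x => poweR x p)
    (r := fun n => rate p alpha (n + d).+1) _ c0 K0 _ _ _ lo _ opt).
  + by rewrite lee_fin.
  + by move=> n; exact: rate_ge0.
  + by move=> n; rewrite /rate addn1 addn2.
  + move=> x y x0 xy; apply: gt0_ler_poweR; rewrite ?in_itv /= ?leey ?andbT //.
      by lra.
    exact: le_trans xy.
  + move=> n; have [Q sQ hQ] := up n; exists Q => //.
    rewrite poweR_lnorm ?taylor_poly; last lra.
    by apply/nneseries_leP => // k; rewrite mulr_ge0 ?powR_ge0.
- move=> pn opt.
  have [c c0 lo] := sup_residual_lower deg_f fz0 Zf alpha.
  have [K K0 up] := sup_residual_upper deg_f fz0 Zf alpha.
  apply: (comparable_optimal (phi := id)
    (r := fun n => sup_rate alpha (n + d).+1) _ c0 K0 _ _ _ lo _ opt).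
  + by rewrite leey.
  + by move=> n; exact: sup_rate_ge0.
  + by move=> n; rewrite /sup_rate addn1 addn2.
  + by [].
  + move=> n; have [Q sQ hQ] := up n; exists Q => //.
    apply/lnorm_leP; rewrite ?leey //; last by rewrite taylor_poly.
    by rewrite mulr_ge0 ?sup_rate_ge0 // ltW.
Qed.
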